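(* Let $d\ge1$, $n\ge d$, and let $S_k=X_1+\dots+X_k$, $S_0:=0$, be a random walk in $\mathbb R^d$ with i.i.d. increments such that $\mathbb P(X_1\in h)=0$ for every affine hyperplane $h\subset\mathbb R^d$. Let $C_n:=\operatorname{conv}(S_0,S_1,\dots,S_n)$, and let $S^{(1)},\dots,S^{(d)}$ be independent copies of the walk $S$. Then $$\mathbb E\operatorname{Vol}_d(C_n)=\frac1{d!}\sum_{\substack{j_1+\dots+j_d\le n\\ j_1,\dots,j_d\ge1}}\frac{\mathbb E\left|\det\left[S^{(1)}_{j_1},\dots,S^{(d)}_{j_d}\right]\right|}{j_1\cdots j_d}.$$
   Context: $\operatorname{Vol}_d$ is $d$-dimensional Lebesgue measure, and $\det[x_1,\dots,x_d]$ is the determinant of the matrix with columns $x_1,\dots,x_d\in\mathbb R^d$. Both sides may be $+\infty$. *)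

(* Defs.v *)
From HB Require Import structures.
From mathcomp Require Import all_boot all_order all_algebra finmap.
From mathcomp Require Import all_classical all_reals all_analysis.
Set Implicit Arguments.
Unset Strict Implicit.
Unset Printing Implicit Defensive.
Import Order.TTheory GRing.Theory Num.Theory.
Import numFieldNormedType.Exports.
Local Open Scope classical_set_scope.
Local Open Scope ring_scope.

Definition measure_matrix_display : measure_display -> measure_display.
Proof. exact. Qed.

(* The product sigma-algebra of the entries. *)
Section measurable_matrix.
Context {disp} {T : measurableType disp}.
Variables m n : nat.

Definition matrix_cylinders : set_system 'M[T]_(m, n) :=
  \bigcup_ij preimage_set_system setT
    (fun M : 'M[T]_(m, n) => M ij.1 ij.2) measurable.

Let matrix_set0 : <<s matrix_cylinders >> set0.
Proof. exact: sigma_algebra0. Qed.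

Let matrix_setC A : <<s matrix_cylinders >> A -> <<s matrix_cylinders >> (~` A).
Proof. exact: sigma_algebraC. Qed.

Let matrix_bigcup (F : (set 'M[T]_(m, n))^nat) :
  (forall i, <<s matrix_cylinders >> (F i)) ->
  <<s matrix_cylinders >> (\bigcup_i F i).
Proof. exact: sigma_algebra_bigcup. Qed.

HB.instance Definition _ := @isMeasurable.Build (measure_matrix_display disp)
  'M[T]_(m, n) <<s matrix_cylinders >> matrix_set0 matrix_setC matrix_bigcup.

Lemma measurable_entry i j : measurable_fun setT (fun M : 'M[T]_(m, n) => M i j).
Proof.
move=> _ Y mY; rewrite setTI; apply: sub_sigma_algebra.
by exists (i, j) => //; exists Y => //; rewrite setTI.
Qed.

Lemma measurable_fun_matrixP disp' (U : measurableType disp')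
    (f : U -> 'M[T]_(m, n)) :
  measurable_fun setT f <-> forall i j, measurable_fun setT (fun x => f x i j).
Proof.
split=> [mf i j|mf].
  exact: (measurableT_comp (measurable_entry i j) mf).
pose G := [set A : set 'M[T]_(m, n) | measurable (f @^-1` A)].
suff sG : <<s matrix_cylinders >> `<=` G by move=> _ A mA; rewrite setTI; exact: sG.
apply: smallest_sub.
  split=> [|A|F]; rewrite /G /=.
  - by rewrite preimage_set0.
  - by rewrite setTD preimage_setC; exact: measurableC.
  - by move=> mF; rewrite preimage_bigcup; exact: bigcup_measurable.
move=> _ [[i j] _ [B mB <-]]; rewrite setTI /G /=.
by have := mf i j measurableT _ mB; rewrite setTI.
Qed.

End measurable_matrix.

Section lebesgue_step.
Context {R : realType} {d : nat}.

Definition cons_vec (p : measurableTypeR R * 'cV[R]_d) : 'cV[R]_d.+1 := col_mx p.1%:M p.2.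

Definition uncons_vec (v : 'cV[R]_d.+1) : measurableTypeR R * 'cV[R]_d :=
  (v ord0 0, \col_i v (lift ord0 i) 0).

Lemma cons_vec0 p : cons_vec p ord0 0 = p.1.
Proof.
rewrite /cons_vec.
rewrite (_ : ord0 = lshift d (ord0 : 'I_1)); last exact: val_inj.
by rewrite (@col_mxEu _ 1 d) mxE eqxx mulr1n.
Qed.

Lemma cons_vecS p i : cons_vec p (lift ord0 i) 0 = p.2 i 0.
Proof.
rewrite /cons_vec.
rewrite (_ : lift ord0 i = rshift 1 i); last exact: val_inj.
by rewrite (@col_mxEd _ 1 d).
Qed.

Lemma cons_vecK : cancel cons_vec uncons_vec.
Proof.
move=> [x v]; rewrite /uncons_vec cons_vec0; congr pair.
by apply/colP => i; rewrite mxE cons_vecS.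
Qed.

Lemma measurable_cons_vec : measurable_fun setT cons_vec.
Proof.
apply/measurable_fun_matrixP => i j; rewrite (ord1 j).
case: (unliftP ord0 i) => [k ->|->].
  rewrite (_ : (fun x => _) = (fun v : 'cV[R]_d => v k 0) \o snd); last first.
    by apply/funext => p /=; rewrite cons_vecS.
  exact: (measurableT_comp (measurable_entry k 0) measurable_snd).
rewrite (_ : (fun x => _) = fst) //.
by apply/funext => p; rewrite cons_vec0.
Qed.

Lemma measurable_uncons_vec : measurable_fun setT uncons_vec.
Proof.
apply: measurable_fun_pair; first exact: measurable_entry.
apply/measurable_fun_matrixP => i j.
rewrite (_ : (fun x => _) = (fun v : 'cV[R]_d.+1 => v (lift ord0 i) 0)).
  exact: measurable_entry.
by apply/funext => v; rewrite mxE.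
Qed.

Variable mu : {sigma_finite_measure set 'cV[R]_d -> \bar R}.

Definition lebesgue_cons : set 'cV[R]_d.+1 -> \bar R :=
  pushforward (@lebesgue_measure R \x mu)%E cons_vec.

Let measurable_preimage_cons A :
  measurable A -> measurable (cons_vec @^-1` A).
Proof. by move=> mA; have := measurable_cons_vec measurableT mA; rewrite setTI. Qed.

Let lebesgue_cons0 : lebesgue_cons set0 = 0%E.
Proof. by rewrite /lebesgue_cons /pushforward preimage_set0 measure0. Qed.

Let lebesgue_cons_ge0 A : (0 <= lebesgue_cons A)%E.
Proof. by rewrite /lebesgue_cons /pushforward; apply: measure_ge0. Qed.

Let lebesgue_cons_semi_sigma_additive : semi_sigma_additive lebesgue_cons.
Proof.
move=> F mF tF mUF; rewrite /lebesgue_cons /pushforward preimage_bigcup.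
apply: measure_semi_sigma_additive.
- by move=> n; exact: measurable_preimage_cons.
- apply/trivIsetP => i j _ _ ij; rewrite -preimage_setI.
  by move/trivIsetP : tF => /(_ _ _ I I ij) ->; rewrite preimage_set0.
- by rewrite -preimage_bigcup; exact: measurable_preimage_cons.
Qed.

HB.instance Definition _ := isMeasure.Build _ _ _ lebesgue_cons
  lebesgue_cons0 lebesgue_cons_ge0 lebesgue_cons_semi_sigma_additive.

Let sigma_finite_lebesgue_cons : sigma_finite setT lebesgue_cons.
Proof.
have /sigma_finiteP[F [TF ndF Foo]] := sigma_finiteT (@lebesgue_measure R).
have /sigma_finiteP[G [TG ndG Goo]] := sigma_finiteT mu.
exists (fun n => uncons_vec @^-1` (F n `*` G n)).
  apply/esym; rewrite -subTset => v _.
  have [k _ Fk] : (\bigcup_k F k) (uncons_vec v).1 by rewrite -TF.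
  have [l _ Gl] : (\bigcup_k G k) (uncons_vec v).2 by rewrite -TG.
  exists (maxn k l) => //; split.
    by move: Fk; exact/subsetPset/ndF/leq_maxl.
  by move: Gl; exact/subsetPset/ndG/leq_maxr.
move=> n; have [mFn Fn] := Foo n; have [mGn Gn] := Goo n.
have mFG : measurable (F n `*` G n) by exact: measurableX.
split; first by have := measurable_uncons_vec measurableT mFG; rewrite setTI.
rewrite /lebesgue_cons /pushforward.
have -> : cons_vec @^-1` (uncons_vec @^-1` (F n `*` G n)) = F n `*` G n.
  by apply/funext => p; rewrite -[in RHS](cons_vecK p).
by rewrite product_measure1E// lte_mul_pinfty// ge0_fin_numE.
Qed.

HB.instance Definition _ := Measure_isSigmaFinite.Build _ _ _ lebesgue_cons
  sigma_finite_lebesgue_cons.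

End lebesgue_step.

(* Identifying R^(d+1) with R * R^d by splitting off the first coordinate,
   d-dimensional Lebesgue measure is the d-fold product of lebesgue_measure;
   on R^0 it is the unit point mass. *)
Fixpoint lebesgue_vec (R : realType) (d : nat) :
    {sigma_finite_measure set 'cV[R]_d -> \bar R} :=
  if d is d'.+1 then lebesgue_cons (lebesgue_vec R d')
  else dirac (0 : 'cV[R]_0).

Definition convex_hull (R : numDomainType) (M : lmodType R) (A : set M) : set M :=
  smallest (@convex_set R M) A.

Definition affine_hyperplane (R : realType) (d : nat) (h : set 'cV[R]_d) :=
  exists (a : 'cV[R]_d) (c : R),
    a != 0 /\ h = [set x | \sum_i a i 0 * x i 0 = c].

(* Trajectories U^nat with the product sigma-algebra. *)
Definition path_cylinders disp (U : measurableType disp) : set_system (nat -> U) :=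
  \bigcup_k preimage_set_system setT (fun x : nat -> U => x k) measurable.

Definition path_space disp (U : measurableType disp) :=
  g_sigma_algebraType (@path_cylinders disp U).

HB.instance Definition _ disp (U : measurableType disp) :=
  Measurable.on (path_space U).

Definition same_distribution (R : realType) dO dO' dU
    (O : measurableType dO) (O' : measurableType dO') (U : measurableType dU)
    (P : probability O R) (P' : probability O' R) (X : O -> U) (Y : O' -> U) :=
  forall A, measurable A -> P (X @^-1` A) = P' (Y @^-1` A).

Definition mutually_independent (R : realType) dO dU (O : measurableType dO)
    (U : measurableType dU) (P : probability O R) (I : choiceType)
    (X : I -> {RV P >-> U}) :=
  forall (J : {fset I}) (B : I -> set U), (forall i, measurable (B i)) ->
    P (\bigcap_(i in [set` J]) (X i @^-1` B i)) =
    (\prod_(i <- J) P (X i @^-1` B i))%E.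

Definition iid (R : realType) dO dU (O : measurableType dO)
    (U : measurableType dU) (P : probability O R) (X : nat -> {RV P >-> U}) :=
  mutually_independent X /\ forall i, same_distribution P P (X i) (X 0%N).

(* The increments are indexed from 0. *)
Definition random_walk (O : Type) (V : nmodType) (X : nat -> O -> V)
    (w : O) (k : nat) : V :=
  \sum_(i < k) X i w.

(* Main.v *)
Require Import Defs.
From HB Require Import structures.
From mathcomp Require Import all_boot all_order all_algebra finmap.
From mathcomp Require Import fingroup perm.
From mathcomp Require Import all_classical all_reals all_analysis.
From mathcomp Require Import measurable_realfun ring lra zify.
From mathcomp Require polyrcf.
Set Implicit Arguments.
Unset Strict Implicit.
Unset Printing Implicit Defensive.
Import Order.TTheory GRing.Theory Num.Theory.
Import numFieldNormedType.Exports.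
Local Open Scope classical_set_scope.
Local Open Scope ring_scope.

(** Lift the walk S to R^(d+1) by a second coordinate, a walk H with generic
    steps t^i.  The lower facets of the convex hull of the lifted walk project to
    simplices that tile C_n, so Vol(C_n) is the sum, over index sets
    a < a + j_1 < a + j_1 + j_2 < ..., of |det| / d! restricted to the lower
    facets; existence and uniqueness of the simplex over a generic point is linear
    programming duality.

    Reordering the steps turns this sum into a count.  Subtract from H the linear
    function of S that interpolates it on the d blocks of steps: the index set is
    a lower facet iff each block becomes a positive bridge, and the walk made of
    the remaining steps attains its minimum at time a.  Exactly one of the j_k
    cyclic shifts of a block is a positive bridge, and the remaining walk has
    exactly one minimum, so averaging over all permutations of the n steps
    replaces the facet condition by 1 / (j_1 ... j_d) and removes a.  This is an
    identity for every sequence of n vectors, in general position or not; the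
    theorem follows by exchangeability. *)

(** * Lebesgue measure and affine maps *)

(** The threshold beyond which the heights t^i are generic depends on the path, so no single lift
    can be fixed before integrating. For one sequence of steps a tie between two gaps is a root of a
    polynomial in t, nonzero unless both times are vertices, and there are only finitely many such
    polynomials, permutations included. The heights are therefore chosen path by path. They occur
    only in the facet condition, which the sum over permutations turns into a number, so the
    identity that is integrated, [sum_perm_hull_volume], no longer mentions them.

    The heights travel with the steps when these are permuted, which is why genericity is asked for
    all permutations at once. Measurability of the volume is obtained by letting t tend to infinity:
    along each path the facet sum is eventually equal to the volume. Degenerate positions need no
    exclusion, because a singular cell has determinant 0 and contributes nothing to either side. *)

Section image_measure.
Context d1 d2 (T1 : measurableType d1) (T2 : measurableType d2) (R : realType).
Variables (mu : {measure set T1 -> \bar R}) (f : T1 -> T2).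
Hypothesis mf : measurable_fun setT f.

(* Unlike [pushforward], this keeps the measurability proof as an argument, from
   which the measure structure can be inferred. *)
Definition image_measure of measurable_fun setT f : set T2 -> \bar R :=
  pushforward mu f.

Let image_measure0 : image_measure mf set0 = 0%E.
Proof. by rewrite /image_measure /pushforward preimage_set0 measure0. Qed.

Let image_measure_ge0 A : (0 <= image_measure mf A)%E.
Proof. exact: measure_ge0. Qed.

Let image_measure_additive : semi_sigma_additive (image_measure mf).
Proof.
move=> F mF tF mUF; rewrite /image_measure /pushforward preimage_bigcup.
apply: measure_semi_sigma_additive.
- by move=> n; rewrite -[X in measurable X]setTI; exact: mf.
- apply/trivIsetP => /= i j _ _ ij; rewrite -preimage_setI.
  by move/trivIsetP : tF => /(_ _ _ _ _ ij) ->//; rewrite preimage_set0.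
- by rewrite -preimage_bigcup -[X in measurable X]setTI; exact: mf.
Qed.

HB.instance Definition _ := isMeasure.Build _ _ _ (image_measure mf)
  image_measure0 image_measure_ge0 image_measure_additive.

End image_measure.

Lemma measurable_fun_mulmx (R : realType) dU (U : measurableType dU) m n p
    (f : U -> 'M[R]_(m, n)) (g : U -> 'M[R]_(n, p)) :
  measurable_fun setT f -> measurable_fun setT g ->
  measurable_fun setT (fun u => f u *m g u).
Proof.
move=> /measurable_fun_matrixP mf /measurable_fun_matrixP mg.
apply/measurable_fun_matrixP => i j; under eq_fun do rewrite mxE.
by apply: measurable_sum => k; exact: measurable_funM.
Qed.

Lemma measurable_fun_addmx (R : realType) dU (U : measurableType dU) m n
    (f g : U -> 'M[R]_(m, n)) :
  measurable_fun setT f -> measurable_fun setT g ->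
  measurable_fun setT (fun u => f u + g u).
Proof.
move=> /measurable_fun_matrixP mf /measurable_fun_matrixP mg.
apply/measurable_fun_matrixP => i j; under eq_fun do rewrite mxE.
exact: measurable_funD.
Qed.

Lemma measurable_fun_oppmx (R : realType) dU (U : measurableType dU) m n
    (f : U -> 'M[R]_(m, n)) :
  measurable_fun setT f -> measurable_fun setT (fun u => - f u).
Proof.
move=> /measurable_fun_matrixP mf.
apply/measurable_fun_matrixP => i j; under eq_fun do rewrite mxE.
exact: measurableT_comp.
Qed.

Section lebesgue_affine.
Context {R : realType}.

Definition affine_map d (B : 'M[R]_d) (c x : 'cV[R]_d) := B *m x + c.

Lemma measurable_affine_map d (B : 'M[R]_d) c :
  measurable_fun setT (affine_map B c).
Proof.
apply: measurable_fun_addmx; last exact: measurable_cst.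
by apply: measurable_fun_mulmx; [exact: measurable_cst|exact: measurable_id].
Qed.

Lemma measurable_affine_preimage d (B : 'M[R]_d) c (A : set 'cV[R]_d) :
  measurable A -> measurable (affine_map B c @^-1` A).
Proof.
by move=> mA; rewrite -[X in measurable X]setTI; exact: measurable_affine_map.
Qed.

Lemma lebesgue_measure_affine (a c : R) (A : set (measurableTypeR R)) :
  a != 0 -> measurable A ->
  lebesgue_measure ((fun x : measurableTypeR R => a * x + c) @^-1` A) =
  ((`|a|^-1)%:E * lebesgue_measure A)%E.
Proof.
move=> a0 mA; pose f (x : measurableTypeR R) : measurableTypeR R := a * x + c.
have mf : measurable_fun setT f.
  by apply: measurable_funD => //; exact: measurable_funM.
have na0 : 0 < `|a| by rewrite normr_gt0.
(* Rescaled by [|a|], the image measure agrees with Lebesgue measure on half-open intervals. The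
   sign of [a] decides which end of the preimage is open. *)
pose m : {measure set (measurableTypeR R) -> \bar R} :=
  mscale (NngNum (ltW na0)) (image_measure (@lebesgue_measure R) mf).
have mE X : lebesgue_measure (f @^-1` X) = ((`|a|^-1)%:E * m X)%E.
  by rewrite /m /mscale /= muleA -EFinM mulVf ?mul1e// gt_eqF.
rewrite -/f mE; congr (_ * _)%E; apply/esym/lebesgue_measure_unique => // X.
move=> [[u v] /= _ <-]; rewrite /m /mscale/= /image_measure /pushforward.
have [a1|a1|a1] := ltgtP a 0; last by rewrite a1 eqxx in a0.
- rewrite (_ : f @^-1` _ = [set` `[(v - c) / a, (u - c) / a[]); last first.
    apply/seteqP; split => x /=; rewrite /f !in_itv/=.
      by rewrite ler_ndivrMr// ltr_ndivlMr//; lra.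
    by rewrite ler_ndivrMr// ltr_ndivlMr//; lra.
  rewrite !lebesgue_measure_itv/= !lte_fin ltr_ndivrMr// divfK// ltrD2r.
  case: ifPn => _; last by rewrite mule0.
  by rewrite -!EFinB -EFinM ltr0_norm//; congr (_%:E); field.
- rewrite (_ : f @^-1` _ = [set` `](u - c) / a, (v - c) / a]]); last first.
    apply/seteqP; split => x /=; rewrite /f !in_itv/=.
      by rewrite ler_pdivlMr// ltr_pdivrMr//; lra.
    by rewrite ler_pdivlMr// ltr_pdivrMr//; lra.
  rewrite !lebesgue_measure_itv/= !lte_fin ltr_pdivrMr// divfK// ltrD2r.
  case: ifPn => _; last by rewrite mule0.
  by rewrite -!EFinB -EFinM gtr0_norm//; congr (_%:E); field.
Qed.

Lemma measurable_cons_preimage d (A : set 'cV[R]_d.+1) :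
  measurable A -> measurable (@cons_vec R d @^-1` A).
Proof.
by move=> mA; rewrite -[X in measurable X]setTI; exact: measurable_cons_vec.
Qed.

Lemma lebesgue_vecS d (A : set 'cV[R]_d.+1) : (lebesgue_vec R d.+1 A =
  \int[@lebesgue_measure R]_x lebesgue_vec R d [set v | A (cons_vec (x, v))])%E.
Proof.
rewrite [LHS]/= /lebesgue_cons /pushforward /product_measure1.
apply: eq_integral => x _ /=; congr (lebesgue_vec R d _).
by apply/seteqP; split => v; rewrite /xsection /= inE.
Qed.

(** Tonelli: with the first coordinate innermost, maps that alter only this coordinate can be
    treated fiber by fiber. *)
Lemma lebesgue_vecS_swap d (A : set 'cV[R]_d.+1) : measurable A ->
  (lebesgue_vec R d.+1 A =
  \int[lebesgue_vec R d]_v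
    @lebesgue_measure R [set x | A (cons_vec (x, v))])%E.
Proof.
move=> /measurable_cons_preimage mA; rewrite lebesgue_vecS.
have := indic_fubini_tonelli (@lebesgue_measure R) (lebesgue_vec R d) mA.
rewrite indic_fubini_tonelli_FE// indic_fubini_tonelli_GE//.
set l := integral _ _ _; set r := integral _ _ _ => lr.
transitivity l.
  apply: eq_integral => x _ /=; congr (lebesgue_vec R d _).
  by apply/seteqP; split => v; rewrite /xsection /= inE.
rewrite lr; apply: eq_integral => v _ /=; congr (lebesgue_measure _).
by apply/seteqP; split => x; rewrite /ysection /= inE.
Qed.

Lemma measurable_consl d (x : R) :
  measurable_fun setT (fun v : 'cV[R]_d => cons_vec (x, v)).
Proof.
apply: (measurableT_comp (@measurable_cons_vec R d)).
exact: measurable_fun_pair.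
Qed.

Lemma measurable_consr d (v : 'cV[R]_d) :
  measurable_fun setT (fun x : measurableTypeR R => cons_vec (x, v)).
Proof.
apply: (measurableT_comp (@measurable_cons_vec R d)).
exact: measurable_fun_pair.
Qed.

Lemma measurable_lebesgue_slice d (A : set 'cV[R]_d.+1) : measurable A ->
  measurable_fun setT
    (fun x : measurableTypeR R => lebesgue_vec R d [set v | A (cons_vec (x, v))]).
Proof.
move=> /measurable_cons_preimage mA.
rewrite (_ : (fun x => _) =
    lebesgue_vec R d \o xsection (@cons_vec R d @^-1` A)).
  exact: measurable_fun_xsection.
apply/funext => x /=; congr (lebesgue_vec R d _).
by apply/seteqP; split => v; rewrite /xsection /= inE.
Qed.

Lemma measurable_lebesgue_fiber d (A : set 'cV[R]_d.+1) : measurable A ->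
  measurable_fun setT (fun v : 'cV[R]_d =>
    @lebesgue_measure R [set x | A (cons_vec (x, v))]).
Proof.
move=> /measurable_cons_preimage mA.
rewrite (_ : (fun v => _) =
    @lebesgue_measure R \o ysection (@cons_vec R d @^-1` A)).
  exact: measurable_fun_ysection.
apply/funext => v /=; congr (lebesgue_measure _).
by apply/seteqP; split => x; rewrite /ysection /= inE.
Qed.

(** Change of variables is phrased with preimages: they are measurable for free and compose without
    inverting [B]. *)
Definition det_scales d (B : 'M[R]_d) (c : 'cV[R]_d) :=
  forall A : set 'cV[R]_d, measurable A ->
  lebesgue_vec R d (affine_map B c @^-1` A) =
  ((`|\det B|^-1)%:E * lebesgue_vec R d A)%E.

Lemma det_scales_comp d (B1 B2 : 'M[R]_d) c1 c2 :
  det_scales B1 c1 -> det_scales B2 c2 ->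
  det_scales (B1 *m B2) (B1 *m c2 + c1).
Proof.
move=> s1 s2 A mA.
rewrite (_ : _ @^-1` _ = affine_map B2 c2 @^-1` (affine_map B1 c1 @^-1` A)).
  rewrite s2; last exact: measurable_affine_preimage.
  by rewrite s1// muleA -EFinM -invfM -normrM mulrC -det_mulmx.
apply/seteqP; split => x; rewrite /affine_map /=.
  by rewrite mulmxDr -mulmxA addrA.
by rewrite mulmxDr -mulmxA addrA.
Qed.

(** On the slice with first coordinate [x] the map is [B] followed by a translation depending on
    [x]; hence the hypothesis for every [c']. *)
Lemma det_scales_lower d (B : 'M[R]_d) (v c : 'cV[R]_d) :
  (forall c', det_scales B c') ->
  @det_scales d.+1 (block_mx (1%:M : 'M[R]_1) 0 v B) (col_mx (0 : 'cV[R]_1) c).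
Proof.
move=> sB A mA; rewrite !lebesgue_vecS (@det_lblock _ 1 d) det1 mul1r.
rewrite -ge0_integralZl//; last exact: measurable_lebesgue_slice.
apply: eq_integral => x _; rewrite -(sB (v *m x%:M + c)); last first.
  by rewrite -[X in measurable X]setTI; exact: measurable_consl.
congr (lebesgue_vec R d _); apply/funext => w /=; congr (A _).
rewrite /affine_map /cons_vec/= (@mul_block_col _ 1 d 1 d).
by rewrite (@add_col_mx _ 1 d 1) mul1mx mul0mx !addr0 [v *m _ + _]addrC addrA.
Qed.

(** With the last [d] coordinates fixed, the map is one-dimensional affine with factor [s]. *)
Lemma det_scales_upper d (s : R) (w : 'rV[R]_d) (c : R) : s != 0 ->
  @det_scales d.+1 (block_mx (s%:M : 'M[R]_1) w 0 1%:M) (col_mx (c%:M : 'cV[R]_1) 0).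
Proof.
move=> s0 A mA; rewrite !lebesgue_vecS_swap//; last exact: measurable_affine_preimage.
rewrite (@det_ublock _ 1 d) det1 mulr1 det_scalar1.
rewrite -ge0_integralZl//; last exact: measurable_lebesgue_fiber.
apply: eq_integral => v _.
rewrite -(@lebesgue_measure_affine _ ((w *m v) 0 0 + c))//; last first.
  by rewrite -[X in measurable X]setTI; exact: measurable_consr.
congr (lebesgue_measure _); apply/funext => x /=; congr (A _).
rewrite /affine_map /cons_vec/= (@mul_block_col _ 1 d 1 d).
rewrite (@add_col_mx _ 1 d 1) mul1mx mul0mx add0r addr0.
apply: (congr1 (fun u : 'cV[R]_1 => col_mx u v)); rewrite [LHS]mx11_scalar.
congr (_%:M).
by rewrite !mxE big_ord1 !mxE eqxx !mulr1n addrA.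
Qed.

(* A singular lower-right block of an invertible matrix is repaired by the shear
   adding the first row to the others with the coefficients of the first column. *)
Lemma unitmx_shear d (a : 'M[R]_1) (w : 'rV[R]_d) (v : 'cV[R]_d) (B : 'M[R]_d) :
  (block_mx a w v B : 'M[R]_(1 + d)) \in unitmx -> B \notin unitmx ->
  v *m w + B \in unitmx.
Proof.
set M := block_mx _ _ _ _ => uM nB.
have Minj (u : 'M[R]_1) (y : 'rV[R]_d) :
    u *m a + y *m v = 0 -> u *m w + y *m B = 0 -> u = 0 /\ y = 0.
  move=> e1 e2; have : row_mx u y *m M = 0.
    by rewrite mul_row_block e1 e2 row_mx0.
  move/(congr1 (mulmx^~ (invmx M))); rewrite mulmxK// mul0mx => /eqP.
  by rewrite row_mx_eq0 => /andP[/eqP-> /eqP->].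
have [y yB y0] : exists2 y : 'rV[R]_d, y *m B = 0 & y != 0.
  have /rowV0Pn[y /sub_kermxP yB y0] : kermx B != 0.
    by rewrite -row_free_unit -kermx_eq0 in nB.
  by exists y.
have yv : y *m v != 0.
  apply: contraNneq y0 => yv; by have [||_ ->] := Minj 0 y; rewrite ?mul0mx ?add0r.
rewrite -row_free_unit -kermx_eq0; apply/rowV0P => z /sub_kermxP.
rewrite mulmxDr mulmxA => zE.
pose t := (z *m v) 0 0; have zv : z *m v = t%:M by exact: mx11_scalar.
pose r := (y *m v) 0 0; have yvE : y *m v = r%:M by exact: mx11_scalar.
have r0 : r != 0.
  by apply: contraNneq yv => r0; rewrite yvE r0 -scalemx1 scale0r.
pose b := a 0 0; have ab : a = b%:M by exact: mx11_scalar.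
(* This row lies in the left kernel of [M]: subtracting a multiple of [y] does not affect the
   product with [B], and [y *m v = r] lets it cancel the first column. *)
have [||u0 z0] := Minj (r * t)%:M (r *: z - (t * b + t) *: y).
- rewrite mulmxBl -!scalemxAl zv yvE ab -scalar_mxM !scale_scalar_mx.
  by apply/matrixP => i j; rewrite !ord1 !mxE eqxx !mulr1n; ring.
- rewrite mulmxBl -!scalemxAl yB scaler0 subr0 mul_scalar_mx -scalerA -scalerDr.
  by rewrite -(mul_scalar_mx t) -zv zE scaler0.
have t0 : t = 0.
  move/matrixP/(_ 0 0): u0; rewrite !mxE eqxx mulr1n => /eqP.
  by rewrite mulf_eq0 (negPf r0) => /eqP.
move: z0; rewrite t0 mul0r addr0 scale0r subr0 => /eqP.
by rewrite scaler_eq0 (negPf r0) => /eqP.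
Qed.

Lemma lebesgue_vec_affine d (B : 'M[R]_d) (c : 'cV[R]_d) :
  B \in unitmx -> det_scales B c.
Proof.
elim: d => [|d IH] in B c *; first move=> _ A mA.
  rewrite [B]flatmx0 det_mx00 normr1 invr1 mul1e.
  congr (lebesgue_vec R 0 _); apply/funext => x /=; congr (A _).
  by rewrite [LHS]flatmx0 [RHS]flatmx0.
(* An invertible lower-right block splits the matrix into an upper and a lower triangular factor,
   with the Schur complement [s] as corner. *)
have schur (a : 'M[R]_1) (w : 'rV[R]_d) (v : 'cV[R]_d) (B' : 'M[R]_d)
    (c0 : R) (c' : 'cV[R]_d) : B' \in unitmx ->
    (block_mx a w v B' : 'M[R]_(1 + d)) \in unitmx ->
    @det_scales d.+1 (block_mx a w v B') (col_mx (c0%:M : 'M[R]_1) c').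
  move=> uB' uB.
  pose s := (a - w *m invmx B' *m v) 0 0.
  have aE : a = s%:M + w *m invmx B' *m v.
    by rewrite -mx11_scalar subrK.
  have BE : block_mx a w v B' = block_mx (s%:M : 'M[R]_1) (w *m invmx B') 0 1%:M *m
      block_mx (1%:M : 'M[R]_1) 0 v B' :> 'M[R]_(1 + d).
    rewrite mulmx_block !mulmx1 !mul0mx !mul1mx mulmx0 !add0r.
    by rewrite mulmxKV// -aE.
  have s0 : s != 0.
    move: uB; rewrite BE unitmx_mul => /andP[+ _].
    by rewrite unitmxE det_ublock det1 mulr1 det_scalar1 unitfE.
  pose e : R := c0 - (w *m invmx B' *m c') 0 0.
  have cE : block_mx (s%:M : 'M[R]_1) (w *m invmx B') 0 1%:M *m
      col_mx (0 : 'cV[R]_1) c' + col_mx e%:M 0 = col_mx c0%:M c'.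
    rewrite mul_block_col add_col_mx mulmx0 mul0mx mul1mx !add0r addr0.
    by rewrite /e raddfB/= -mx11_scalar addrC subrK.
  rewrite BE -cE; apply: (@det_scales_comp d.+1); first exact: det_scales_upper.
  by apply: det_scales_lower => c''; exact: IH.
rewrite -[B](@submxK _ 1 d 1 d) -[c](@vsubmxK _ 1 d 1).
move: (ulsubmx _) (ursubmx _) (dlsubmx _) (drsubmx _) => a w v B'.
rewrite [usubmx _]mx11_scalar; move: (usubmx _ 0 0) (dsubmx _) => c0 c' uB.
have [uB'|nB'] := boolP (B' \in unitmx); first exact: schur.
(* Otherwise the shear [E v] makes that block invertible, and undoing it is a map covered by
   [det_scales_lower]. *)
pose E (u : 'cV[R]_d) : 'M[R]_(1 + d) := block_mx 1%:M 0 u 1%:M.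
have EE u u' : E u *m E u' = E (u + u').
  by rewrite /E mulmx_block !mulmx1 !mul1mx !mul0mx !mulmx0 !addr0 add0r.
have E0 : E 0 = 1%:M by rewrite /E -scalar_mx_block.
have EK : E (- v) *m E v = 1%:M by rewrite EE addNr.
have EM : E v *m block_mx a w v B' = block_mx a w (v *m a + v) (v *m w + B').
  by rewrite /E mulmx_block !mul1mx !mul0mx !addr0.
have BE : block_mx a w v B' = E (- v) *m block_mx a w (v *m a + v) (v *m w + B').
  by rewrite -EM mulmxA EK mul1mx.
have uE : block_mx a w (v *m a + v) (v *m w + B') \in unitmx.
  rewrite -EM unitmx_mul uB andbT; have /mulmx1_unit[]// := EK.
have cE : E (- v) *m col_mx c0%:M (v *m c0%:M + c') + col_mx 0 0 = col_mx c0%:M c'.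
  rewrite /E mul_block_col add_col_mx !mul1mx mul0mx !addr0.
  by rewrite mulNmx addrA addNr add0r.
rewrite BE -cE; apply: (@det_scales_comp d.+1).
  by apply: det_scales_lower => u; apply: IH; exact: unitmx1.
apply: schur => //; exact: unitmx_shear uB nB'.
Qed.

End lebesgue_affine.

(** * Volume of the ordered simplex *)

Section order_simplex.
Context {R : realType}.

(* The chain t, s_0, ..., s_(d-1), 0, 0, ... *)
Definition order_chain d (t : R) (s : 'cV[R]_d) (k : nat) : R :=
  if k is k'.+1 then if insub k' is Some i then s i 0 else 0 else t.

(** Consecutive differences of the chain will be the barycentric weights. Strictness makes all d + 1
    of them positive, so that simplices over distinct facets are disjoint. *)
Definition order_simplex d (t : R) : set 'cV[R]_d :=
  [set s | forall k, (k <= d)%N -> order_chain t s k.+1 < order_chain t s k].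

Lemma order_chainS d (t : R) (s : 'cV[R]_d) (i : 'I_d) :
  order_chain t s i.+1 = s i 0.
Proof. by rewrite /order_chain /= valK. Qed.

Lemma order_chain_default d (t : R) (s : 'cV[R]_d) k :
  (d <= k)%N -> order_chain t s k.+1 = 0.
Proof. by move=> dk; rewrite /order_chain insubN// -leqNgt. Qed.

Lemma order_chain_cons d (t x : R) (v : 'cV[R]_d) k :
  order_chain t (cons_vec (x, v)) k.+1 = order_chain x v k.
Proof.
case: (ltnP k d.+1) => [kd|dk]; last first.
  by case: k dk => // k dk; rewrite !order_chain_default.
rewrite -[k]/(val (Ordinal kd)) order_chainS.
case: (unliftP ord0 (Ordinal kd)) => [i ->|->].
  by rewrite cons_vecS order_chainS.
by rewrite cons_vec0.
Qed.

Lemma order_simplexS d (t x : R) (v : 'cV[R]_d) :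
  order_simplex t (cons_vec (x, v)) <-> x < t /\ order_simplex x v.
Proof.
split=> [h|[xt h] [|k] kd].
- split; first by have := h 0 (leq0n _); rewrite order_chain_cons.
  by move=> k kd; have := h k.+1 kd; rewrite !order_chain_cons.
- by rewrite order_chain_cons.
- by rewrite !order_chain_cons; exact: h.
Qed.

Lemma order_simplex_gt0 d (t : R) (s : 'cV[R]_d) : order_simplex t s -> 0 < t.
Proof.
move=> h; have : forall k, (k <= d)%N -> 0 < order_chain t s (d - k).
  elim=> [_|k IH kd].
    by have := h d (leqnn _); rewrite order_chain_default ?subn0.
  apply: lt_trans (IH (ltnW kd)) _.
  by have := h (d - k.+1)%N (leq_subr _ _); rewrite -subSn// subSS.
by move=> /(_ d (leqnn _)); rewrite subnn.
Qed.

Lemma measurable_order_chain d (t : R) k :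
  measurable_fun setT (fun s : 'cV[R]_d => order_chain t s k).
Proof.
case: k => [|k]; first exact: measurable_cst.
rewrite /order_chain; case: insubP => [i _ _|_]; last exact: measurable_cst.
exact: measurable_entry.
Qed.

Lemma measurable_lt_set dU (U : measurableType dU) (f g : U -> R) :
  measurable_fun setT f -> measurable_fun setT g ->
  measurable [set u | f u < g u].
Proof.
move=> mf mg; rewrite (_ : [set _ | _] = (fun u => f u < g u) @^-1` [set true]).
  rewrite -[X in measurable X]setTI.
  exact: (measurable_fun_ltr mf mg measurableT).
by apply/seteqP; split => u.
Qed.

Lemma measurable_eq_set dU (U : measurableType dU) (f g : U -> R) :
  measurable_fun setT f -> measurable_fun setT g ->
  measurable [set u | f u = g u].
Proof.
move=> mf mg; rewrite (_ : [set _ | _] = (fun u => f u == g u) @^-1` [set true]).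
  rewrite -[X in measurable X]setTI.
  exact: (measurable_fun_eqr mf mg measurableT).
by apply/seteqP; split => u /= /eqP.
Qed.

Lemma measurable_order_simplex d (t : R) : measurable (@order_simplex d t).
Proof.
rewrite (_ : order_simplex _ = \bigcap_(k in [set k | (k <= d)%N])
    [set s | order_chain t s k.+1 < order_chain t s k])//.
apply: bigcap_measurableType => k _.
by apply: measurable_lt_set; exact: measurable_order_chain.
Qed.

Lemma integral_exprn (n : nat) (t : R) : 0 < t ->
  (\int[@lebesgue_measure R]_(x in `]0%R, t[) (x ^+ n / n`!%:R)%:E =
   (t ^+ n.+1 / n.+1`!%:R)%:E)%E.
Proof.
move=> t0; pose f (x : R) : R := x ^+ n / n`!%:R.
pose F (x : R) : R := x ^+ n.+1 / n.+1`!%:R.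
have cF m (r : R) : continuous (fun x : R => x ^+ m / r).
  by move=> x; apply: cvgM; [exact: exprn_continuous|exact: cvg_cst].
have dF x : derivable F x 1 
  by apply: derivableM; [exact: exprn_derivable|exact: derivable_cst].
have mf D : measurable_fun D (EFin \o f).
  apply/measurable_EFinP; apply: measurable_funTS.
  by apply: continuous_measurable_fun; exact: cF.
rewrite (integral_itv_bndo_bndc (mf _)) (integral_itv_obnd_cbnd (mf _)).
rewrite (@continuous_FTC2 _ f F)//.
- by rewrite /F expr0n/= mul0r oppr0 addr0.
- exact/continuous_subspaceT/cF.
- split=> [x _//||].
  + exact/cvg_at_right_filter/cF.
  + exact/cvg_at_left_filter/cF.
- move=> x _; rewrite /F derive1Mr//; last exact: exprn_derivable.
  rewrite derive1E exp_derive /f factS natrM invfM scaler1.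
  by rewrite -[_ *: _]/(_ * _) mulrACA divff ?mul1r ?pnatr_eq0.
Qed.

(** Induction on [d]: the slice at first coordinate [x] is the simplex of size [x] if 0 < x < t, and
    empty otherwise. *)
Lemma lebesgue_order_simplex d (t : R) : 0 < t ->
  lebesgue_vec R d (order_simplex t) = (t ^+ d / d`!%:R)%:E.
Proof.
elim: d t => [|d IH] t t0.
  rewrite expr0 fact0 divr1 (_ : order_simplex t = setT); first exact: diracT.
  apply/seteqP; split => // s _ [|//] _.
  by rewrite order_chain_default.
rewrite lebesgue_vecS -integral_exprn// [RHS]integral_mkcond.
apply: eq_integral => x _; rewrite patchE; case: ifPn.
  rewrite inE/= in_itv/= => /andP[x0 xt]; rewrite -IH//.
  congr (lebesgue_vec R d _); apply/seteqP; split => v /=.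
    by move/order_simplexS => [].
  by move=> xv; exact/order_simplexS.
rewrite notin_setE /= in_itv/= => /negP/nandP xN.
rewrite (_ : [set _ | _] = set0) ?measure0//.
apply/seteqP; split => // v /order_simplexS[xt /order_simplex_gt0 x0].
by case: xN => /negP.
Qed.

End order_simplex.

Section hyperplane.
Context {R : realType}.

Lemma measurable_hyperplane d (h : set 'cV[R]_d) :
  affine_hyperplane h -> measurable h.
Proof.
move=> [a [c [_ ->]]]; apply: measurable_eq_set => //.
apply: measurable_sum => i; apply: measurable_funM => //.
exact: measurable_entry.
Qed.

(** If the normal vector has a nonzero tail, every slice is a hyperplane in one dimension less;
    otherwise every fiber along the first coordinate is a single point. *)
Lemma lebesgue_hyperplane d (h : set 'cV[R]_d) :
  affine_hyperplane h -> lebesgue_vec R d h = 0%E.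
Proof.
elim: d h => [|d IH] h; first by move=> [a [c [+ _]]]; rewrite [a]flatmx0 eqxx.
move=> hh; have mh := measurable_hyperplane hh; case: hh => a [c [a0 hE]].
pose a' : 'cV[R]_d := \col_i a (lift ord0 i) 0.
have hC x v : h (cons_vec (x, v)) <->
    \sum_i a' i 0 * v i 0 = c - a ord0 0 * x.
  rewrite hE /= big_ord_recl cons_vec0.
  rewrite (eq_bigr (fun i => a' i 0 * v i 0)) => [|i _]; last first.
    by rewrite cons_vecS mxE.
  by split => [<-|->] /=; ring.
have [a'0|a'0] := eqVneq a' 0; last first.
  rewrite lebesgue_vecS integral0_eq// => x _; apply: IH.
  exists a', (c - a ord0 0 * x); split => //.
  by apply/seteqP; split => v /hC.
have a00 : a ord0 0 != 0.
  apply: contra_neq a0 => a00; apply/colP => i; rewrite mxE.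
  case: (unliftP ord0 i) => [j ->|->//].
  by move/colP/(_ j): a'0; rewrite !mxE.
rewrite lebesgue_vecS_swap// integral0_eq// => v _.
rewrite (_ : [set _ | _] = [set c / a ord0 0]) ?lebesgue_measure_set1//.
apply/seteqP; split => x /=.
  move/hC; rewrite a'0 big1 => [e|i _]; last by rewrite mxE mul0r.
  by rewrite (_ : c = a ord0 0 * x) 1?mulrC ?mulKf//; lra.
move=> ->; apply/hC; rewrite a'0 big1 => [|i _]; last by rewrite mxE mul0r.
by rewrite mulrC divfK// subrr.
Qed.

End hyperplane.

(** * Convex combinations and linear programming *)

Section weights.
Context {R : realFieldType} {V : lmodType R} {T : finType}.
Variable p : T -> V.

Definition convex_weights (x : V) (l : T -> R) :=
  [/\ forall k, 0 <= l k, \sum_k l k = 1 & \sum_k l k *: p k = x].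

Definition affine_relation (m : T -> R) :=
  \sum_k m k = 0 /\ \sum_k m k *: p k = 0.

Definition affinely_free (I : {set T}) :=
  forall m, affine_relation m -> (forall k, k \notin I -> m k = 0) ->
  forall k, m k = 0.

Definition weight_supp (l : T -> R) : {set T} := finset (fun k => l k != 0).

Lemma weight_supp_notin l (I : {set T}) k :
  weight_supp l = I -> k \notin I -> l k = 0.
Proof. by move=> <-; rewrite inE negbK => /eqP. Qed.

Lemma affine_relationN m :
  affine_relation m -> affine_relation (fun k => - m k).
Proof.
move=> [m0 mp]; split; first by rewrite sumrN m0 oppr0.
by under eq_bigr do rewrite scaleNr; rewrite sumrN mp oppr0.
Qed.

Lemma affine_relation_neg m k : affine_relation m -> m k != 0 ->
  exists i, m i < 0.
Proof.
move=> [m0 _] mk; apply/existsP; apply: contraNT mk => /existsPn mge.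
have {}mge i : 0 <= m i by rewrite leNgt; exact: mge.
by move/psumr_eq0P: m0 => -> // i _; exact: mge.
Qed.

Lemma convex_weights_move x l m t : convex_weights x l -> affine_relation m ->
  (forall k, 0 <= l k + t * m k) -> convex_weights x (fun k => l k + t * m k).
Proof.
move=> [l0 l1 lx] [m0 mp] lt; split => //.
  by rewrite big_split/= -mulr_sumr m0 mulr0 addr0.
under eq_bigr do rewrite scalerDl -scalerA.
by rewrite big_split/= -scaler_sumr mp scaler0 addr0.
Qed.

Variable H : T -> R.

(** Carathéodory's argument with an objective: move along an affine relation inside the support,
    oriented so that the objective does not grow, until a weight vanishes. *)
Lemma weights_reduce x l : convex_weights x l ->
  exists2 l', convex_weights x l' & affinely_free (weight_supp l') /\
    \sum_k l' k * H k <= \sum_k l k * H k.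
Proof.
move: {2}#|_| (leqnn #|weight_supp l|) => N.
elim: N l => [|N IH] l lN lw.
  case: lw => _ l1 _; move: lN; rewrite leqn0 cards_eq0 => /eqP l0.
  have := oner_neq0 R; rewrite -l1 big1 ?eqxx// => k _; apply/eqP.
  have : k \notin weight_supp l by rewrite l0 inE.
  by rewrite inE negbK.
have [lf|] := pselect (affinely_free (weight_supp l)); first by exists l.
move=> /existsNP[m0 /not_implyP[m0r /not_implyP[m0I /existsNP[k0 /eqP mk0]]]].
have [m [mr mI mk mH]] : exists m, [/\ affine_relation m,
    forall k, k \notin weight_supp l -> m k = 0, m k0 != 0 &
    \sum_k m k * H k <= 0].
  have [?|?] := leP (\sum_k m0 k * H k) 0; first by exists m0.
  exists (fun k => - m0 k); split; rewrite ?oppr_eq0//.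
  - exact: affine_relationN.
  - by move=> k kI; rewrite m0I ?oppr0.
  - by under eq_bigr do rewrite mulNr; rewrite sumrN oppr_le0 ltW.
have [i0 mi0] := affine_relation_neg mr mk.
have lge0 k : 0 <= l k by case: lw.
(* Ratio test: the largest step that keeps all weights nonnegative; it annihilates the weight at
   [i]. *)
case: (@Order.TotalTheory.arg_minP _ _ _ i0 (fun k => m k < 0)
  (fun k => l k / - m k) mi0) => i mi imin.
pose t := l i / - m i.
have t0 : 0 <= t by rewrite divr_ge0// oppr_ge0 ltW.
pose l1 k := l k + t * m k.
have l1w : convex_weights x l1.
  apply: convex_weights_move => // k.
  have [mk_lt|mk_ge] := ltP (m k) 0; last by rewrite addr_ge0// mulr_ge0.
  have := imin k mk_lt; rewrite -/t ler_pdivlMr ?oppr_gt0// => ?; lra.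
have l1i : l1 i = 0.
  by rewrite /l1 /t invrN mulrN mulNr divfK ?subrr// lt_eqF.
have [|//|l' l'w [l'f l'H]] := IH l1.
  rewrite -ltnS (leq_trans _ lN)//; apply: proper_card.
  apply/properP; split.
    apply/fintype.subsetP => k; rewrite !inE; apply: contra => /eqP lk.
    by rewrite /l1 lk mI ?inE ?lk ?eqxx// mulr0 addr0.
  exists i; rewrite !inE ?l1i ?eqxx//.
  by apply: contraTN mi => li; rewrite mI ?ltxx// inE negbK.
exists l' => //; split => //; apply: le_trans l'H _.
rewrite /l1; under eq_bigr do rewrite mulrDl -mulrA.
by rewrite big_split/= -mulr_sumr gerDl mulr_ge0_le0.
Qed.

(** An affinely free support carries at most one weight function for [x], so by [weights_reduce] the
    minimum is taken over finitely many supports and no compactness is involved. *)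
Lemma weights_minimal x l0 : convex_weights x l0 ->
  exists2 l, convex_weights x l & affinely_free (weight_supp l) /\
    forall l', convex_weights x l' ->
      \sum_k l k * H k <= \sum_k l' k * H k.
Proof.
move=> lw0.
pose ok I l := [/\ convex_weights x l, weight_supp l = I & affinely_free I].
have okH I l l' : ok I l -> ok I l' -> l =1 l'.
  move=> [[_ l1 lx] lI If] [[_ l1' lx'] lI' _] k; apply/eqP.
  rewrite -subr_eq0; apply/eqP; apply: (If (fun k => l k - l' k)).
    split; first by rewrite sumrB l1 l1' subrr.
    under eq_bigr do rewrite scalerBl.
    by rewrite sumrB lx lx' subrr.
  by move=> {}k kI; rewrite (weight_supp_notin lI kI) (weight_supp_notin lI' kI) subrr.
pose feas I := `[< exists l, ok I l >].
pose wt I := xget l0 (ok I).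
have wtP I : feas I -> ok I (wt I).
  by move=> /asboolP[l okl]; apply: xgetPex; exists l.
have red l' : convex_weights x l' -> exists2 I, feas I &
    \sum_k wt I k * H k <= \sum_k l' k * H k.
  move=> /weights_reduce[l lw [lf lH]].
  have okl : ok (weight_supp l) l by [].
  have fI : feas (weight_supp l) by apply/asboolP; exists l.
  exists (weight_supp l) => //; apply: le_trans lH.
  by under eq_bigr do rewrite (okH _ _ _ (wtP _ fI) okl).
have [I0 fI0 _] := red _ lw0.
case: (@Order.TotalTheory.arg_minP _ _ _ I0 feas
  (fun I => \sum_k wt I k * H k) fI0) => I fI Imin.
have [Iw IE If] := wtP _ fI.
exists (wt I) => //; split; first by rewrite IE.
by move=> l' /red[J /Imin]; exact: le_trans.
Qed.

(** First-order optimality: a small move along [m] stays feasible, because [m] is negative only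
    where [l] is positive. *)
Lemma weights_minimal_relation x l m : convex_weights x l ->
  (forall l', convex_weights x l' ->
    \sum_k l k * H k <= \sum_k l' k * H k) ->
  affine_relation m -> (forall k, m k < 0 -> 0 < l k) ->
  0 <= \sum_k m k * H k.
Proof.
move=> lw lmin mr mneg.
have lge0 k : 0 <= l k by case: lw.
have [t t0 tl] : exists2 t, 0 < t & forall k, 0 <= l k + t * m k.
  have [/existsP[i0 mi0]|/existsPn mge] := boolP [exists k, m k < 0]; last first.
    by exists 1 => // k; rewrite addr_ge0// mul1r leNgt mge.
  case: (@Order.TotalTheory.arg_minP _ _ _ i0 (fun k => m k < 0)
    (fun k => l k / - m k) mi0) => i mi imin.
  exists (l i / - m i); first by rewrite divr_gt0 ?oppr_gt0// mneg.
  move=> k; have [mk_lt|mk_ge] := ltP (m k) 0; last first.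
    by rewrite addr_ge0// mulr_ge0// divr_ge0// oppr_ge0 ltW.
  have := imin k mk_lt; rewrite ler_pdivlMr ?oppr_gt0// => ?; lra.
have := lmin _ (convex_weights_move lw mr tl).
under [X in _ <= X]eq_bigr do rewrite mulrDl -mulrA.
by rewrite big_split/= -mulr_sumr lerDl pmulr_rge0.
Qed.

End weights.

Section convex_hull.
Context {R : realFieldType} {V : lmodType R} {T : finType}.
Variable p : T -> V.

Lemma convex_setP (C : set V) : convex_set C <->
  forall t x y, 0 <= t -> t <= 1 -> C x -> C y -> C (t *: x + (1 - t) *: y).
Proof.
split=> [cC t x y t0 t1 Cx Cy|cC x y t Cx Cy].
  have := cC x y (Itv01 t0 t1); rewrite !inE; exact.
by rewrite inE; apply: cC; rewrite ?le1//; exact/set_mem.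
Qed.

Lemma convex_set_sum (C : set V) (I : Type) (r : seq I) (l : I -> R) (q : I -> V) :
  convex_set C -> (forall i, 0 <= l i) -> (forall i, C (q i)) ->
  \sum_(i <- r) l i = 1 -> C (\sum_(i <- r) l i *: q i).
Proof.
move=> /convex_setP cC l0 Cq.
(* Partial sums of the weights need not be 1, so the induction runs on the normalized mean. *)
suff H : 0 < \sum_(i <- r) l i ->
    C ((\sum_(i <- r) l i)^-1 *: \sum_(i <- r) l i *: q i).
  by move=> e; move: H; rewrite e ltr01 invr1 scale1r; exact.
elim: r => [|i r IH]; first by rewrite big_nil ltxx.
rewrite !big_cons; set s := \sum_(_ <- _) l _; set y := \sum_(_ <- _) _ *: _.
have s0 : 0 <= s by apply: sumr_ge0.
have [s_gt0|s_le0] := ltP 0 s => ls.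
  have ls0 : l i + s != 0 by rewrite gt_eqF.
  have -> : (l i + s)^-1 *: (l i *: q i + y) =
      (l i / (l i + s)) *: q i + (1 - l i / (l i + s)) *: (s^-1 *: y).
    rewrite scalerDr !scalerA [_^-1 * l i]mulrC; congr (_ + _ *: _).
    by field; rewrite ls0 gt_eqF.
  apply: cC => //; last exact: IH.
    by rewrite divr_ge0 ?addr_ge0.
  by rewrite ler_pdivrMr// mul1r lerDl.
have se : s = 0 by apply/eqP; rewrite eq_le s0 s_le0.
have -> : y = 0.
  rewrite /y; move: se; rewrite /s; elim: (r) => [|k r' IHr]; first by rewrite !big_nil.
  rewrite !big_cons => /eqP; rewrite paddr_eq0 ?sumr_ge0// => /andP[/eqP-> /eqP/IHr->].
  by rewrite scale0r addr0.
move: ls; rewrite se !addr0 => li.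
by rewrite scalerA mulVf ?scale1r// gt_eqF.
Qed.

Lemma convex_hullE : convex_hull (range p) =
  [set x | exists l, convex_weights p x l].
Proof.
apply/seteqP; split => x.
  apply; split => [|_ [k _ <-]]; last first.
    exists (fun i => (i == k)%:R); split => [i||]; first exact: ler0n.
      by rewrite (bigD1 k)//= eqxx big1 ?addr0// => i /negPf->.
    rewrite (bigD1 k)//= eqxx scale1r big1 ?addr0// => i /negPf->.
    by rewrite scale0r.
  apply/convex_setP => t u v t0 t1 [l [l0 l1 lu]] [m [m0 m1 mv]].
  exists (fun i => t * l i + (1 - t) * m i); split => [i||].
  - by rewrite addr_ge0// mulr_ge0// subr_ge0.
  - by rewrite big_split/= -!mulr_sumr l1 m1; ring.
  - under eq_bigr do rewrite scalerDl -!scalerA.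
    by rewrite big_split/= -!scaler_sumr lu mv.
move=> [l [l0 l1 <-]] C [cC pC]; apply: convex_set_sum => // k.
by apply: pC; exists k.
Qed.

End convex_hull.

(** * Barycentric coordinates and measurability of the hull *)

Section barycentric.
Context {R : realType} {d : nat} {T : finType}.
Variable p : T -> 'cV[R]_d.

(** The leading 1 turns affine combinations into linear ones, so that affine independence becomes
    row freeness of [point_matrix]. *)
Definition homogenize (x : 'cV[R]_d) : 'rV[R]_(1 + d) := row_mx 1%:M x^T.

Definition point_matrix (I : {set T}) : 'M[R]_(#|I|, 1 + d) :=
  row_mx (const_mx 1) (\matrix_(i, j) p (enum_val i) j 0).

Lemma mul_point_matrix (I : {set T}) (u : 'rV[R]_#|I|) :
  u *m point_matrix I =
  row_mx (\sum_i u 0 i)%:M (\sum_i u 0 i *: p (enum_val i))^T.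
Proof.
rewrite mul_mx_row; congr row_mx.
  rewrite [LHS]mx11_scalar mxE; congr (_%:M).
  by apply: eq_bigr => i _; rewrite mxE mulr1.
apply/rowP => j; rewrite !mxE summxE.
by apply: eq_bigr => i _; rewrite !mxE.
Qed.

Lemma point_matrixP (I : {set T}) (u : 'rV[R]_#|I|) x :
  u *m point_matrix I = homogenize x <->
  \sum_i u 0 i = 1 /\ \sum_i u 0 i *: p (enum_val i) = x.
Proof.
rewrite mul_point_matrix /homogenize; split=> [/eq_row_mx[e1 e2]|[-> ->]//].
split; last by apply: trmx_inj.
by move/matrixP/(_ 0 0): e1; rewrite !mxE eqxx !mulr1n.
Qed.

Definition extend_weights (I : {set T}) (u : 'rV[R]_#|I|) (k : T) : R :=
  \sum_(i | enum_val i == k) u 0 i.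

Lemma extend_weights_val (I : {set T}) (u : 'rV[R]_#|I|) i :
  extend_weights u (enum_val i) = u 0 i.
Proof.
rewrite /extend_weights (bigD1 i)//= big1 ?addr0// => j /andP[/eqP e].
by rewrite (enum_val_inj e) eqxx.
Qed.

Lemma extend_weights_notin (I : {set T}) (u : 'rV[R]_#|I|) k :
  k \notin I -> extend_weights u k = 0.
Proof.
move=> kI; rewrite /extend_weights big_pred0// => i.
by apply: contraNF kI => /eqP <-; exact: enum_valP.
Qed.

Lemma sum_extend_weights (I : {set T}) (u : 'rV[R]_#|I|) (V : lmodType R)
    (f : T -> V) :
  \sum_k extend_weights u k *: f k = \sum_i u 0 i *: f (enum_val i).
Proof.
under eq_bigr do rewrite scaler_suml.
rewrite (exchange_big_dep predT)//=; apply: eq_bigr => i _.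
by rewrite (big_pred1 (enum_val i))// => k; rewrite eq_sym.
Qed.

Lemma sum_extend_weights1 (I : {set T}) (u : 'rV[R]_#|I|) :
  \sum_k extend_weights u k = \sum_i u 0 i.
Proof.
have := sum_extend_weights u (fun=> 1 : R^o).
under eq_bigr do rewrite /GRing.scale /= mulr1.
by under [in RHS]eq_bigr do rewrite /GRing.scale /= mulr1.
Qed.

Lemma affinely_free_row_free (I : {set T}) :
  affinely_free p I -> row_free (point_matrix I).
Proof.
move=> If; rewrite -kermx_eq0; apply/rowV0P => u /sub_kermxP.
rewrite mul_point_matrix => /eqP; rewrite row_mx_eq0 => /andP[/eqP e1 /eqP e2].
apply/rowP => i; rewrite mxE -extend_weights_val; apply: If.
  split.
    by rewrite sum_extend_weights1; move/matrixP/(_ 0 0): e1; rewrite !mxE eqxx mulr1n.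
  rewrite sum_extend_weights; apply: trmx_inj; by rewrite e2 trmx0.
by move=> k; exact: extend_weights_notin.
Qed.

Lemma affinely_free_card (I : {set T}) : affinely_free p I -> (#|I| <= d.+1)%N.
Proof.
by move=> /affinely_free_row_free /eqP <-; exact: rank_leq_col.
Qed.

Lemma convex_weights_restrict (I : {set T}) x l : convex_weights p x l ->
  weight_supp l \subset I ->
  (\row_i l (enum_val i)) *m point_matrix I = homogenize x.
Proof.
move=> [_ l1 lx] /fintype.subsetP lI; have l0 k : k \notin I -> l k = 0.
  by move=> /(contra (lI k)); rewrite inE negbK => /eqP.
apply/point_matrixP; split.
  under eq_bigr do rewrite mxE.
  rewrite -(big_enum_val (fun k => l k)) -l1 [RHS](bigID (mem I))/=.
  by rewrite [X in _ = _ + X]big1 ?addr0// => k /l0.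
under eq_bigr do rewrite mxE.
rewrite -(big_enum_val (fun k => l k *: p k)) -lx [RHS](bigID (mem I))/=.
by rewrite [X in _ = _ + X]big1 ?addr0// => k /l0->; rewrite scale0r.
Qed.

(* For affinely independent points the barycentric coordinates are linear in
   the homogenized point, which makes the set of points with nonnegative
   coordinates measurable. *)
Lemma convex_hull_bigcup : convex_hull (range p) =
  \bigcup_(I in [set: {set T}])
    ([set x | forall i, 0 <= (homogenize x *m pinvmx (point_matrix I)) 0 i] `&`
     [set x | homogenize x *m pinvmx (point_matrix I) *m point_matrix I =
              homogenize x]).
Proof.
rewrite convex_hullE; apply/seteqP; split => x /=.
  move=> [l0 /(weights_reduce (fun=> 0))[l lw [lf _]]].
  exists (weight_supp l) => //=; have := convex_weights_restrict lw (subxx _).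
  set u := \row_i _ => uE.
  have -> : homogenize x *m pinvmx (point_matrix (weight_supp l)) = u.
    by rewrite -uE -mulmxA mulmxVp ?mulmx1//; exact: affinely_free_row_free.
  by split => // i; rewrite mxE; case: lw.
move=> [I _ [/=]]; set u := _ *m pinvmx _ => u0 /point_matrixP[u1 ux].
exists (extend_weights u); split.
- by move=> k; apply: sumr_ge0.
- by rewrite sum_extend_weights1.
- by rewrite sum_extend_weights.
Qed.

Lemma measurable_homogenize : measurable_fun setT homogenize.
Proof.
apply/measurable_fun_matrixP => i j; rewrite /homogenize.
case: (split_ordP j) => k ->.
  by under eq_fun do rewrite row_mxEl; exact: measurable_cst.
by under eq_fun do rewrite row_mxEr mxE; exact: measurable_entry.
Qed.

Lemma measurable_convex_hull : measurable (convex_hull (range p)).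
Proof.
rewrite convex_hull_bigcup; apply: fin_bigcup_measurable => // I _.
have mu : measurable_fun setT
    (fun x => homogenize x *m pinvmx (point_matrix I)).
  apply: measurable_fun_mulmx; first exact: measurable_homogenize.
  exact: measurable_cst.
apply: measurableI.
  rewrite (_ : [set _ | _] = \bigcap_(i in [set: 'I_#|I|])
      [set x | 0 <= (homogenize x *m pinvmx (point_matrix I)) 0 i]); last first.
    by apply/seteqP; split => x /= h i => [_|]; exact: h.
  apply: fin_bigcap_measurable => // i _.
  rewrite (_ : [set _ | _] =
      ~` [set x | (homogenize x *m pinvmx (point_matrix I)) 0 i < 0]).
    apply/measurableC/measurable_lt_set => //.
    by move/measurable_fun_matrixP: mu; exact.
  by apply/seteqP; split => x /=; rewrite leNgt => /negP.
rewrite (_ : [set _ | _] = \bigcap_(j in [set: 'I_(1 + d)])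
    [set x | (homogenize x *m pinvmx (point_matrix I) *m point_matrix I) 0 j =
             homogenize x 0 j]); last first.
  apply/seteqP; split => x /= h; first by move=> j _ /=; rewrite h.
  by apply/rowP => j; exact: h.
apply: fin_bigcap_measurable => // j _; apply: measurable_eq_set.
  have := measurable_fun_mulmx mu (@measurable_cst _ _ _ _ _ (point_matrix I)).
  by move/measurable_fun_matrixP; exact.
by have /measurable_fun_matrixP := measurable_homogenize; exact.
Qed.

(** At most [d] homogenized points span a proper subspace, so a nontrivial affine equation holds on
    their hull; and there are finitely many supports. *)
Lemma negligible_deficient : (lebesgue_vec R d).-negligible
  [set x | exists2 l, convex_weights p x l & (#|weight_supp l| <= d)%N].
Proof.
have null (I : {set T}) : (#|I| <= d)%N -> (lebesgue_vec R d).-negligible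
    [set x | exists2 l, convex_weights p x l & weight_supp l = I].
  move=> Id; have /rowV0Pn[z /sub_kermxP zI z0] : kermx (point_matrix I)^T != 0.
    rewrite -mxrank_eq0 mxrank_ker mxrank_tr -lt0n subn_gt0.
    by rewrite (leq_ltn_trans (rank_leq_row _)).
  pose a : 'cV[R]_d := (rsubmx z)^T; pose c := lsubmx z 0 0.
  have hE x : homogenize x *m z^T = (c + \sum_i a i 0 * x i 0)%:M.
    rewrite -[z]hsubmxK tr_row_mx mul_row_col mul1mx [LHS]mx11_scalar.
    congr (_%:M); rewrite !mxE; congr (_ + _); first by rewrite /c mxE.
    by apply: eq_bigr => i _; rewrite !mxE mulrC.
  have hI x l : convex_weights p x l -> weight_supp l = I ->
      c + \sum_i a i 0 * x i 0 = 0.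
    move=> lw lI; have : homogenize x *m z^T = 0.
      rewrite -(convex_weights_restrict (I := I) lw) ?lI//.
      by rewrite -mulmxA -[X in _ *m X]trmxK trmx_mul trmxK zI trmx0 mulmx0.
    by rewrite hE => /matrixP/(_ 0 0); rewrite !mxE eqxx mulr1n.
  (* With [a = 0] the equation reads [c = 0] although [c != 0], so no point satisfies it. *)
  have [a0|a0] := eqVneq a 0.
    have c0 : c != 0.
      apply: contra_neq z0 => c0; rewrite -[z]hsubmxK.
      rewrite [lsubmx z]mx11_scalar -/c c0 -[rsubmx z]trmxK -/a a0 trmx0.
      by rewrite raddf0 row_mx0.
    exists set0; split => // x [l lw lI].
    have := hI _ _ lw lI; rewrite a0 big1 ?addr0 => [c0'|i _].
      by rewrite c0' eqxx in c0.
    by rewrite mxE mul0r.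
  pose h := [set x : 'cV[R]_d | \sum_i a i 0 * x i 0 = - c].
  have hh : affine_hyperplane h by exists a, (- c).
  exists h; split; [exact: measurable_hyperplane|exact: lebesgue_hyperplane|].
  move=> x [l lw lI]; have := hI _ _ lw lI.
  by move/eqP; rewrite addrC addr_eq0 => /eqP.
apply: (@negligibleS _ _ _ _ (\big[setU/set0]_(I : {set T} | (#|I| <= d)%N)
    [set x | exists2 l, convex_weights p x l & weight_supp l = I])).
  by move=> x [l lw ld]; rewrite (bigD1 (weight_supp l))//=; left; exists l.
apply: big_ind => [|A B|I]; [exact: negligible_set0|exact: negligibleU|].
exact: null.
Qed.

End barycentric.

(** * Facets of the lifted walk *)

Definition psum (V : nmodType) (f : nat -> V) (q : nat) : V := \sum_(i < q) f i.

Section offset.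
Variable d : nat.
Implicit Types (j : 'I_d -> nat) (a k q : nat).

Definition offset j k := (\sum_(l < d | (l < k)%N) j l)%N.

Definition vertex a j k := (a + offset j k)%N.

Definition is_vertex a j q := [exists k : 'I_d.+1, q == vertex a j k].

Lemma offset0 j : offset j 0 = 0%N.
Proof. by rewrite /offset big_pred0. Qed.

Lemma offsetS j (k : 'I_d) : offset j k.+1 = (offset j k + j k)%N.
Proof.
rewrite /offset (bigD1 k)//= addnC; congr addn.
by apply: eq_bigl => l; rewrite ltnS ltn_neqAle andbC.
Qed.

Lemma offset_full j : offset j d = (\sum_k j k)%N.
Proof. by apply: eq_bigl => k; rewrite ltn_ord. Qed.

Lemma vertex0 a j : vertex a j 0 = a.
Proof. by rewrite /vertex offset0 addn0. Qed.

Lemma vertexS a j (k : 'I_d) : vertex a j k.+1 = (vertex a j k + j k)%N.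
Proof. by rewrite /vertex offsetS addnA. Qed.

Lemma leq_offset j k k' : (k <= k')%N -> (offset j k <= offset j k')%N.
Proof.
move=> kk'; rewrite /offset big_mkcond [leqRHS]big_mkcond/=; apply: leq_sum => l _.
by case: ifPn => // lk; rewrite (leq_trans lk).
Qed.

Lemma leq_vertex a j k k' : (k <= k')%N -> (vertex a j k <= vertex a j k')%N.
Proof. by move=> kk'; rewrite leq_add2l leq_offset. Qed.

Lemma ltn_vertex a j k k' : (forall l, 0 < j l)%N -> (k < k' <= d)%N ->
  (vertex a j k < vertex a j k')%N.
Proof.
move=> j0 /andP[kk' k'd]; have kd : (k < d)%N by rewrite (leq_trans kk').
rewrite (leq_trans _ (leq_vertex a j kk'))//.
by have := vertexS a j (Ordinal kd) => /= ->; rewrite -addn1 leq_add2l.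
Qed.

Lemma vertex_inj a j (k k' : 'I_d.+1) : (forall l, 0 < j l)%N ->
  vertex a j k = vertex a j k' -> k = k'.
Proof.
move=> j0 e; apply/val_inj; case: (ltngtP k k') => // kk'.
  have := @ltn_vertex a j k k' j0; rewrite kk' -ltnS ltn_ord e ltnn.
  by move/(_ isT).
have := @ltn_vertex a j k' k j0; rewrite kk' -ltnS ltn_ord e ltnn.
by move/(_ isT).
Qed.

Lemma vertex_is_vertex a j k : (k <= d)%N -> is_vertex a j (vertex a j k).
Proof. by rewrite -ltnS => kd; apply/existsP; exists (Ordinal kd). Qed.

Lemma is_vertex_leq a j q : is_vertex a j q -> (a <= q <= a + \sum_k j k)%N.
Proof.
move=> /existsP[k /eqP->]; rewrite leq_addr/= leq_add2l -offset_full.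
by rewrite leq_offset// -ltnS.
Qed.

(** Positive lengths list the vertices in strictly increasing order, and a sorted list is determined
    by its elements. *)
Lemma eq_vertices a j a' j' : (forall l, 0 < j l)%N -> (forall l, 0 < j' l)%N ->
  is_vertex a j =1 is_vertex a' j' -> a = a' /\ j =1 j'.
Proof.
move=> j0 j0' e.
have sv b i : (forall l, 0 < i l)%N ->
    sorted ltn [seq vertex b i k | k <- iota 0 d.+1].
  move=> i0; apply/(sortedP 0%N) => k; rewrite size_map size_iota => kd.
  rewrite !(nth_map 0%N) ?size_iota ?(ltnW kd)// !nth_iota ?(ltnW kd)//.
  by rewrite !add0n; apply: ltn_vertex; rewrite ?ltnSn.
have ev b i q : (q \in [seq vertex b i k | k <- iota 0 d.+1]) = is_vertex b i q.
  apply/mapP/existsP => [[k + ->]|[k /eqP->]].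
    by rewrite mem_iota/= add0n => kd; exists (Ordinal kd).
  by exists (val k) => //; rewrite mem_iota/= add0n.
have E : [seq vertex a j k | k <- iota 0 d.+1] =
         [seq vertex a' j' k | k <- iota 0 d.+1].
  apply: (irr_sorted_eq ltn_trans ltnn); [exact: sv|exact: sv|].
  by move=> q; rewrite !ev.
have {E}E k : (k <= d)%N -> vertex a j k = vertex a' j' k.
  move=> kd; have := congr1 (nth 0%N ^~ k) E.
  by rewrite !(nth_map 0%N) ?size_iota// !nth_iota.
split; first by have := E 0%N (leq0n _); rewrite !vertex0.
move=> k; have := E k.+1 (ltn_ord k); rewrite !vertexS E ?(ltnW (ltn_ord k))//.
exact: addnI.
Qed.

End offset.

Section facet.
Context {R : realType} {d : nat}.
Implicit Types (j : 'I_d -> nat) (a k q : nat) (s : 'cV[R]_d).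

(** Abel summation: it passes from barycentric weights to coordinates along the edges between
    consecutive vertices. *)
Lemma sum_chain (V : lmodType R) (t : R) s (f : nat -> V) :
  \sum_(k < d.+1) (order_chain t s k - order_chain t s k.+1) *: f k =
  t *: f 0%N + \sum_(k < d) s k 0 *: (f k.+1 - f k).
Proof.
have H (c : nat -> R) N : \sum_(k < N.+1) (c k - c k.+1) *: f k =
    c 0%N *: f 0%N + \sum_(k < N) c k.+1 *: (f k.+1 - f k) - c N.+1 *: f N.
  elim: N => [|N IH]; first by rewrite big_ord1 big_ord0 addr0 scalerBl.
  rewrite big_ord_recr/= IH [in RHS]big_ord_recr/= scalerBl scalerBr.
  by rewrite -!addrA; congr (_ + (_ + _)); exact: addrCA.
rewrite H order_chain_default// scale0r subr0; congr (_ + _).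
by apply: eq_bigr => k _; rewrite order_chainS.
Qed.

(** Barycentric weights of the point with edge coordinates [s], spread over all times. Their total
    is [t]: 1 gives convex weights, 0 gives candidates for affine relations. *)
Definition vertex_weights a j t s q : R :=
  \sum_(k < d.+1 | vertex a j k == q)
    (order_chain t s k - order_chain t s k.+1).

Lemma sum_vertex_weights n a j t s (V : lmodType R) (f : nat -> V) :
  (a + \sum_k j k <= n)%N ->
  \sum_(q < n.+1) vertex_weights a j t s q *: f q =
  t *: f a + \sum_(k < d) s k 0 *: (f (vertex a j k.+1) - f (vertex a j k)).
Proof.
move=> ajn; have := sum_chain t s (fun k => f (vertex a j k)).
rewrite vertex0 => <-; under eq_bigr do rewrite scaler_suml.
rewrite (exchange_big_dep predT)//=; apply: eq_bigr => k _.
have kn : (vertex a j k < n.+1)%N.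
  rewrite ltnS (leq_trans _ ajn)// leq_add2l -offset_full leq_offset//.
  by rewrite -ltnS.
by rewrite (big_pred1 (Ordinal kn))// => q; rewrite -val_eqE/= eq_sym.
Qed.

Lemma vertex_weightsE a j t s (k : 'I_d.+1) : (forall l, 0 < j l)%N ->
  vertex_weights a j t s (vertex a j k) =
  order_chain t s k - order_chain t s k.+1.
Proof.
move=> j0; rewrite /vertex_weights (big_pred1 k)// => k'.
by apply/eqP/eqP => [/vertex_inj->|->].
Qed.

Lemma vertex_weights_notin a j t s q :
  ~~ is_vertex a j q -> vertex_weights a j t s q = 0.
Proof.
move=> /existsPn qv; rewrite /vertex_weights big_pred0// => k.
by rewrite eq_sym; exact/negbTE.
Qed.

Variables (x : nat -> 'cV[R]_d) (h : nat -> R).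

Definition step_matrix a j : 'M[R]_d := \matrix_(i, k)
  (psum x (vertex a j k.+1) - psum x (vertex a j k)) i 0.

Definition step_heights a j : 'rV[R]_d := \row_k
  (psum h (vertex a j k.+1) - psum h (vertex a j k)).

(* The gradient of the affine function interpolating the heights at the
   vertices; it is only meaningful when the steps are linearly independent. *)
Definition slope a j : 'rV[R]_d :=
  (\det (step_matrix a j))^-1 *: (step_heights a j *m \adj (step_matrix a j)).

(** Only the linear part of the interpolating function is subtracted: for an invertible step matrix
    the vertices share a common value, which need not be 0. *)
Definition gap a j q : R := psum h q - (slope a j *m psum x q) 0 0.

Definition lower_facet n a j :=
  [forall q : 'I_n.+1, ~~ is_vertex a j q ==> (gap a j a < gap a j q)].

Definition facet_simplex a j : set 'cV[R]_d :=
  [set y | order_simplex 1 (invmx (step_matrix a j) *m (y - psum x a))].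

Lemma mul_step_matrix a j s : step_matrix a j *m s =
  \sum_k s k 0 *: (psum x (vertex a j k.+1) - psum x (vertex a j k)).
Proof.
apply/colP => i; rewrite summxE mxE; apply: eq_bigr => k _.
by rewrite mxE [in RHS]mxE mulrC.
Qed.

Lemma mul_step_heights a j s : (step_heights a j *m s) 0 0 =
  \sum_k s k 0 * (psum h (vertex a j k.+1) - psum h (vertex a j k)).
Proof. by rewrite mxE; apply: eq_bigr => k _; rewrite mxE mulrC. Qed.

Lemma slopeE a j : step_matrix a j \in unitmx ->
  slope a j = step_heights a j *m invmx (step_matrix a j).
Proof. by move=> u; rewrite /invmx u -scalemxAr. Qed.

Lemma slope_step a j : step_matrix a j \in unitmx ->
  slope a j *m step_matrix a j = step_heights a j.
Proof. by move=> u; rewrite slopeE// mulmxKV. Qed.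

Lemma gap_vertex a j k : step_matrix a j \in unitmx -> (k <= d)%N ->
  gap a j (vertex a j k) = gap a j a.
Proof.
move=> u; elim: k => [|k IH] kd; first by rewrite vertex0.
rewrite -IH ?(ltnW kd)//; pose k' := Ordinal kd.
have e : (slope a j *m (psum x (vertex a j k.+1) - psum x (vertex a j k))) 0 0 =
    psum h (vertex a j k.+1) - psum h (vertex a j k).
  have := congr1 (fun r : 'rV[R]_d => r 0 k') (slope_step u).
  rewrite [in RHS]mxE => <-; rewrite !mxE.
  by apply: eq_bigr => i _; rewrite [step_matrix _ _ _ _]mxE.
move: e; rewrite mulmxBr mxE [X in _ + X]mxE /gap => e; lra.
Qed.

Lemma sum_gap n a j (l : 'I_n.+1 -> R) y :
  convex_weights (fun q : 'I_n.+1 => psum x q) y l ->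
  \sum_q l q * gap a j q = \sum_q l q * psum h q - (slope a j *m y) 0 0.
Proof.
move=> [_ _ <-]; under eq_bigr do rewrite mulrBr.
rewrite sumrB; congr (_ - _); rewrite mulmx_sumr summxE.
by apply: eq_bigr => q _; rewrite -scalemxAr [in RHS]mxE.
Qed.

Lemma facet_simplex_weights n a j y : (forall l, 0 < j l)%N ->
  (a + \sum_k j k <= n)%N -> step_matrix a j \in unitmx ->
  facet_simplex a j y ->
  exists2 l : 'I_n.+1 -> R, convex_weights (fun q : 'I_n.+1 => psum x q) y l &
    forall q : 'I_n.+1, (0 < l q) = is_vertex a j q.
Proof.
move=> j0 ajn u; rewrite /facet_simplex /=; set s := _ *m _ => ys.
pose l (q : 'I_n.+1) := vertex_weights a j 1 s q.
have lv (q : 'I_n.+1) : (0 < l q) = is_vertex a j q.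
  have [/existsP[k /eqP qk]|qv] := boolP (is_vertex a j q).
    rewrite /l qk vertex_weightsE// subr_gt0; apply: ys.
    by rewrite -ltnS.
  by rewrite /l vertex_weights_notin// ltxx.
exists l => //; split.
- move=> q; have [/existsP[k /eqP qk]|qv] := boolP (is_vertex a j q).
    rewrite ltW// lv; apply/existsP; exists k; exact/eqP.
  by rewrite /l vertex_weights_notin.
- have := sum_vertex_weights 1 s (fun=> 1 : R^o) ajn.
  rewrite [X in _ = _ + X]big1 => [|k _]; last by rewrite subrr scaler0.
  rewrite addr0 scale1r => <-; apply: eq_bigr => q _.
  by rewrite /GRing.scale/= mulr1.
- rewrite /l (sum_vertex_weights 1 s (psum x) ajn) -mul_step_matrix.
  by rewrite /s mulKVmx// scale1r addrC subrK.
Qed.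

Lemma weights_facet_simplex n a j y (l : 'I_n.+1 -> R) : (forall l, 0 < j l)%N ->
  (a + \sum_k j k <= n)%N -> step_matrix a j \in unitmx ->
  convex_weights (fun q : 'I_n.+1 => psum x q) y l ->
  (forall q : 'I_n.+1, (0 < l q) = is_vertex a j q) ->
  facet_simplex a j y.
Proof.
move=> j0 ajn u [l0 l1 ly] lv.
pose lw k := l (inord (vertex a j k)).
have vn k : (k <= d)%N -> (vertex a j k < n.+1)%N.
  by move=> kd; rewrite ltnS (leq_trans _ ajn)// leq_add2l -offset_full leq_offset.
(* Inverse of the Abel summation: edge coordinates are tail sums of the weights. *)
pose s : 'cV[R]_d := \col_(k < d) \sum_(k.+1 <= m < d.+1) lw m.
have sE k : (k <= d.+1)%N -> order_chain 1 s k = \sum_(k <= m < d.+1) lw m.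
  case: k => [_|k]; last first.
    rewrite ltnS leq_eqVlt => /predU1P[->|kd].
      by rewrite order_chain_default// big_geq.
    by rewrite (order_chainS 1 s (Ordinal kd)) mxE.
  rewrite /= -l1 big_mkord.
  transitivity (\sum_(q < n.+1) \sum_(k < d.+1 | vertex a j k == q) l q).
    apply: eq_bigr => q _; have [/existsP[k /eqP qk]|qv] := boolP (is_vertex a j q).
      by rewrite (big_pred1 k)// => k'; rewrite qk; apply/eqP/eqP => [/vertex_inj->|->].
    have lq : l q = 0 by apply/eqP; rewrite eq_le l0 andbT leNgt lv.
    by rewrite big1// lq.
  rewrite (exchange_big_dep predT)//=; apply: eq_bigr => k _.
  have kn : (vertex a j k < n.+1)%N by apply: vn; rewrite -ltnS.
  rewrite (big_pred1 (Ordinal kn)) => [|q]; last first.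
    by apply/eqP/eqP => [e|->//]; exact: val_inj.
  by rewrite /lw; congr (l _); apply: val_inj; rewrite /= inordK.
have sD k : (k <= d)%N -> order_chain 1 s k - order_chain 1 s k.+1 = lw k.
  move=> kd; rewrite !sE ?(leqW kd)// (big_ltn (n := d.+1))// addrK//.
have lE (q : 'I_n.+1) : l q = vertex_weights a j 1 s q.
  have [/existsP[k /eqP qk]|qv] := boolP (is_vertex a j q).
    have kd : (k <= d)%N by rewrite -ltnS.
    rewrite qk (vertex_weightsE a 1 s k j0) (sD k kd) /lw -qk; congr (l _).
    by apply: val_inj; rewrite /= inordK.
  rewrite vertex_weights_notin//; apply/eqP; by rewrite eq_le l0 andbT leNgt lv.
have ys : y = psum x a + step_matrix a j *m s.
  rewrite -ly; under eq_bigr do rewrite lE.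
  by rewrite (sum_vertex_weights 1 s (psum x) ajn) -mul_step_matrix scale1r.
rewrite /facet_simplex/= ys [psum x a + _]addrC addrK mulKmx// => k kd.
by rewrite -subr_gt0 sD// lv /= inordK ?vn// vertex_is_vertex.
Qed.

End facet.

(** * The unique facet below a generic point *)

Section facet_decomposition.
Context {R : realType} {d : nat}.
Variables (n : nat) (x : nat -> 'cV[R]_d) (h : nat -> R).
Implicit Types (j : 'I_d -> nat) (a : nat).

Let p (q : 'I_n.+1) := psum x q.

(** Ties are excluded between any two times, not only with a vertex: the minima counted after
    rotation compare times that are not vertices with each other. *)
Definition generic_heights := forall a j, (forall l, 0 < j l)%N ->
  (a + \sum_k j k <= n)%N -> step_matrix x a j \in unitmx ->
  forall q q' : nat, (q < q' <= n)%N -> gap x h a j q = gap x h a j q' ->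
  is_vertex a j q /\ is_vertex a j q'.

Lemma lower_facet_gap a j (q : 'I_n.+1) : step_matrix x a j \in unitmx ->
  lower_facet x h n a j -> gap x h a j a <= gap x h a j q ?= iff is_vertex a j q.
Proof.
move=> u /forallP/(_ q); case: (boolP (is_vertex a j q)) => [/existsP[k /eqP->] _|qv /= lt].
  by rewrite gap_vertex ?leq_ord//; apply/leifP; rewrite eqxx.
exact/leifP.
Qed.

(** Weak duality with complementary slackness: the affine function of the facet lies below the
    lifted walk and bounds the height of every representation of [y], with equality only for weights
    on the vertices. *)
Lemma lower_facet_weights a j y l : step_matrix x a j \in unitmx ->
  lower_facet x h n a j -> convex_weights p y l ->
  gap x h a j a <= \sum_q l q * psum h q - (slope x h a j *m y) 0 0
    ?= iff [forall q : 'I_n.+1, (0 < l q) ==> is_vertex a j q].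
Proof.
move=> u low lw; rewrite -(sum_gap h a j lw); case: lw => l0 l1 _.
rewrite -{1}[gap x h a j a]mul1r -l1 mulr_suml.
have := @leif_sum _ 'I_n.+1 predT (fun q => (0 < l q) ==> is_vertex a j q)
  (fun q => l q * gap x h a j a) (fun q => l q * gap x h a j q).
apply => q _; have := l0 q; rewrite le_eqVlt => /predU1P[<-|lq].
  by rewrite /= !mul0r ltxx; apply/leif_refl.
rewrite lq /=; have [le e] := lower_facet_gap q u low.
by split; [rewrite ler_pM2l|rewrite -e (inj_eq (mulfI (lt0r_neq0 lq)))].
Qed.

(** Each facet's weights for [y] are optimal, so they also attain the bound given by the other
    facet; hence each vertex set contains the other. *)
Lemma facet_unique a j a' j' y :
  (forall l, 0 < j l)%N -> (a + \sum_k j k <= n)%N ->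
  (forall l, 0 < j' l)%N -> (a' + \sum_k j' k <= n)%N ->
  step_matrix x a j \in unitmx -> step_matrix x a' j' \in unitmx ->
  lower_facet x h n a j -> lower_facet x h n a' j' ->
  facet_simplex x a j y -> facet_simplex x a' j' y ->
  a = a' /\ j =1 j'.
Proof.
move=> j0 ajn j0' ajn' u u' low low' ya ya'.
have [l lw lv] := facet_simplex_weights j0 ajn u ya.
have [l' lw' lv'] := facet_simplex_weights j0' ajn' u' ya'.
have := lower_facet_weights u low lw; have := lower_facet_weights u low lw'.
have := lower_facet_weights u' low' lw; have := lower_facet_weights u' low' lw'.
have -> : [forall q : 'I_n.+1, (0 < l q) ==> is_vertex a j q].
  by apply/forallP => q; rewrite lv implybb.
have -> : [forall q : 'I_n.+1, (0 < l' q) ==> is_vertex a' j' q].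
  by apply/forallP => q; rewrite lv' implybb.
move: (gap x h a j a) (gap x h a' j' a') => g g'.
move: ((slope x h a j *m y) 0 0) ((slope x h a' j' *m y) 0 0) => s s'.
move: (\sum_q l q * _) (\sum_q l' q * _) => A A'.
move=> [_ /eqP e1] [le2 e2] [le3 e3] [_ /eqP e4].
have AA' : A = A' by lra.
have /forallP v1 : [forall q : 'I_n.+1, (0 < l q) ==> is_vertex a' j' q].
  by rewrite -e2; apply/eqP; lra.
have /forallP v2 : [forall q : 'I_n.+1, (0 < l' q) ==> is_vertex a j q].
  by rewrite -e3; apply/eqP; lra.
apply: eq_vertices => // q; apply/idP/idP => qv.
  have qn : (q < n.+1)%N by have /andP[_ /leq_trans] := is_vertex_leq qv; exact.
  by have := v1 (Ordinal qn); rewrite lv /= qv.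
have qn : (q < n.+1)%N by have /andP[_ /leq_trans] := is_vertex_leq qv; exact.
by have := v2 (Ordinal qn); rewrite lv' /= qv.
Qed.

(** Strong duality: a minimal solution with affinely free support uses exactly d + 1 times, which
    become the vertices, and its optimality is the facet inequality. *)
Lemma facet_exists y l0 : generic_heights -> convex_weights p y l0 ->
  (forall l, convex_weights p y l -> (d < #|weight_supp l|)%N) ->
  exists a j, [/\ forall l, (0 < j l)%N, (a + \sum_k j k <= n)%N,
    step_matrix x a j \in unitmx, lower_facet x h n a j &
    facet_simplex x a j y].
Proof.
move=> gen lw0 ygen.
have [l lw [lf lmin]] := weights_minimal (fun q : 'I_n.+1 => psum h q) lw0.
have lge0 q : 0 <= l q by case: lw.
have cl : #|weight_supp l| = d.+1.
  by apply/eqP; rewrite eqn_leq (affinely_free_card lf)/= ygen.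
pose es := [seq val q | q <- enum (weight_supp l)].
have es_size : size es = d.+1 by rewrite size_map -cardE.
have es_sorted : sorted ltn es.
  rewrite sorted_map; apply: sorted_filter => [q q' q''|]; first exact: ltn_trans.
  by rewrite -enumT -sorted_map val_enum_ord; exact: iota_ltn_sorted.
have es_mem (q : 'I_n.+1) : (val q \in es) = (0 < l q).
  by rewrite mem_map ?mem_enum ?inE; [rewrite lt_neqAle eq_sym lge0 andbT|exact: val_inj].
pose e := nth 0%N es.
have e_lt k k' : (k < k' <= d)%N -> (e k < e k')%N.
  move=> /andP[kk' k'd]; apply: (sorted_ltn_nth ltn_trans) => //;
  by rewrite inE es_size ltnS // (leq_trans (ltnW kk')).
pose a := e 0%N; pose j (k : 'I_d) := (e k.+1 - e k)%N.
have j0 k : (0 < j k)%N by rewrite subn_gt0 e_lt// leqnn ltn_ord.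
have ve k : (k <= d)%N -> vertex a j k = e k.
  elim: k => [|k IH] kd; first exact: vertex0.
  have := vertexS a j (Ordinal kd) => /= ->; rewrite IH 1?ltnW// /j /= subnKC//.
  by rewrite ltnW// e_lt// ltnSn.
have vP (q : 'I_n.+1) : (0 < l q) = is_vertex a j q.
  rewrite -es_mem; apply/(nthP 0%N)/existsP => [[k]|[k /eqP qk]].
    by rewrite es_size => kd <-; exists (Ordinal kd); rewrite ve.
  exists (val k); first by rewrite es_size ltn_ord.
  by rewrite -[LHS]/(e k) -ve ?leq_ord.
have ajn : (a + \sum_k j k <= n)%N.
  rewrite -offset_full -[(_ + _)%N]/(vertex a j d) ve//.
  have /mapP[q _ ->] : e d \in es by rewrite mem_nth// es_size.
  exact: leq_ord.
have wI t s k : k \notin weight_supp l -> vertex_weights (R := R) a j t s (val k) = 0.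
  move=> kI; apply: vertex_weights_notin; rewrite -vP lt_neqAle lge0 andbT negbK.
  by move: kI; rewrite inE negbK eq_sym.
have u : step_matrix x a j \in unitmx.
  rewrite -unitmx_tr -row_free_unit -kermx_eq0; apply/rowV0P => v /sub_kermxP vM.
  pose s := v^T.
  have Ms : step_matrix x a j *m s = 0 by rewrite -[X in X *m _]trmxK -trmx_mul vM trmx0.
  (* A kernel vector of the step matrix is an affine relation on the support; freeness makes its
     chain constant, and the chain starts at 0. *)
  have r : affine_relation p (fun q => vertex_weights a j 0 s q).
    split; last first.
      by rewrite /p (sum_vertex_weights 0 s (psum x) ajn) -mul_step_matrix Ms scale0r addr0.
    have := sum_vertex_weights 0 s (fun=> 1 : R^o) ajn.
    rewrite [X in _ = _ + X]big1 => [|k _]; last by rewrite subrr scaler0.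
    rewrite addr0 scale0r => e0; rewrite -[RHS]e0; apply: eq_bigr => q _.
    by rewrite /GRing.scale/= mulr1.
  have w0 := lf _ r (wI _ _).
  have c0 k : (k <= d.+1)%N -> order_chain 0 s k = 0.
    elim: k => // k IH kd; have vkn : (vertex a j k < n.+1)%N.
      by rewrite ltnS (leq_trans _ ajn)// leq_add2l -offset_full leq_offset.
    have := w0 (Ordinal vkn); rewrite /= (vertex_weightsE a 0 s (Ordinal kd) j0).
    by rewrite IH 1?ltnW// sub0r => /eqP; rewrite oppr_eq0 => /eqP.
  apply/rowP => k; have := c0 k.+1 (leqW (ltn_ord k)).
  by rewrite order_chainS !mxE.
exists a, j; split => //; last exact: weights_facet_simplex vP.
apply/forallP => q; apply/implyP => qv.
(* Genericity upgrades the weak inequality to a strict one. *)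
suff : gap x h a j a <= gap x h a j q.
  rewrite le_eqVlt => /predU1P[e1|//].
  have [qa|qa|qa] := ltngtP (val q) a.
  - have [|] := gen a j j0 ajn u (val q) a _ (esym e1).
      by rewrite qa (leq_trans _ ajn)// leq_addr.
    by rewrite (negPf qv).
  - have [|_] := gen a j j0 ajn u a (val q) _ e1.
      by rewrite qa leq_ord.
    by rewrite (negPf qv).
  - move: qv; rewrite -[nat_of_ord q]/(val q) qa.
    by rewrite -[X in is_vertex _ _ X](vertex0 a j) vertex_is_vertex.
(* The point at time [q] is written affinely in terms of the vertices. The resulting relation is
   negative at most on vertices, where [l] is positive, and its objective is the reduced cost of
   [q]. *)
pose s := invmx (step_matrix x a j) *m (psum x q - psum x a).
pose m (k : 'I_n.+1) : R := (k == q)%:R - vertex_weights a j 1 s k.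
have mE (V : lmodType R) (f : nat -> V) : \sum_k m k *: f k = f q -
    (f a + \sum_k s k 0 *: (f (vertex a j k.+1) - f (vertex a j k))).
  under eq_bigr do rewrite scalerBl; rewrite sumrB.
  rewrite (sum_vertex_weights 1 s f ajn) scale1r; congr (_ - _).
  rewrite (bigD1 q)//= eqxx scale1r big1 ?addr0// => k /negPf->.
  by rewrite scale0r.
have mr : affine_relation p m.
  split; last first.
    rewrite /p (mE _ (psum x)) -mul_step_matrix mulKVmx//.
    by rewrite [psum x a + _]addrC subrK subrr.
  have := mE _ (fun=> 1 : R^o).
  rewrite [X in _ = _ - (_ + X)]big1 => [|k _]; last by rewrite subrr scaler0.
  rewrite addr0 subrr => e0; rewrite -[RHS]e0; apply: eq_bigr => k _.
  by rewrite /GRing.scale/= mulr1.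
have := weights_minimal_relation lw lmin mr.
have -> : \sum_k m k * psum h k = gap x h a j q - gap x h a j a.
  have := mE R^o (psum h); rewrite /GRing.scale/= => ->.
  rewrite -mul_step_heights /s mulmxA -slopeE// mulmxBr mxE [X in _ - (_ + (_ + X))]mxE /gap; lra.
rewrite subr_ge0; apply => k; rewrite vP; apply: contraLR => kv.
rewrite /m vertex_weights_notin// subr0 -leNgt; exact: ler0n.
Qed.

End facet_decomposition.

Lemma measure_big_setU dT (T : measurableType dT) (R : realType)
    (mu : {measure set T -> \bar R}) (I : eqType) (r : seq I) (F : I -> set T) :
  uniq r -> (forall i, measurable (F i)) ->
  (forall i k, i \in r -> k \in r -> i != k -> F i `&` F k = set0) ->
  mu (\big[setU/set0]_(i <- r) F i) = (\sum_(i <- r) mu (F i))%E.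
Proof.
elim: r => [_ _ _|i r IH /= /andP[ir ur] mF dF]; first by rewrite !big_nil measure0.
have mr : measurable (\big[setU/set0]_(k <- r) F k).
  by apply: bigsetU_measurable.
rewrite !big_cons -IH//; last first.
  by move=> k l kr lr; apply: dF; rewrite in_cons ?kr ?lr orbT.
rewrite measureU// big_distrr/= big_seq big1// => k kr.
by apply: dF; rewrite ?mem_head ?in_cons ?kr ?orbT//; apply: contraNneq ir => ->.
Qed.

(** * The volume of the hull as a sum over facets *)

Section volume.
Context {R : realType} {d : nat}.
Implicit Types (j : 'I_d -> nat) (a : nat).

Lemma measurable_facet_simplex (x : nat -> 'cV[R]_d) a j :
  measurable (facet_simplex x a j).
Proof.
rewrite (_ : facet_simplex x a j = affine_map (invmx (step_matrix x a j))
    (- (invmx (step_matrix x a j) *m psum x a)) @^-1` order_simplex 1).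
  by apply: measurable_affine_preimage; exact: measurable_order_simplex.
by apply/funext => y; rewrite /facet_simplex /affine_map /= mulmxBr.
Qed.

Lemma lebesgue_facet_simplex (x : nat -> 'cV[R]_d) a j :
  step_matrix x a j \in unitmx -> lebesgue_vec R d (facet_simplex x a j) =
  (`|\det (step_matrix x a j)| / d`!%:R)%:E.
Proof.
move=> u; rewrite (_ : facet_simplex x a j = affine_map (invmx (step_matrix x a j))
    (- (invmx (step_matrix x a j) *m psum x a)) @^-1` order_simplex 1).
  rewrite lebesgue_vec_affine ?unitmx_inv//; last exact: measurable_order_simplex.
  by rewrite lebesgue_order_simplex// expr1n det_inv normfV invrK -EFinM div1r.
by apply/funext => y; rewrite /facet_simplex /affine_map /= mulmxBr.
Qed.

Definition facet_weight n (x : nat -> 'cV[R]_d) (h : nat -> R) a j : R :=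
  (lower_facet x h n a j)%:R * `|\det (step_matrix x a j)|.

Definition composition n j := [forall k, 1 <= j k]%N && (\sum_k j k <= n)%N.

(** The open facet simplices are disjoint by [facet_unique]; by [facet_exists] they miss only points
    that are convex combinations of at most [d] positions, a null set. *)
Lemma lebesgue_convex_hull n (x : nat -> 'cV[R]_d) (h : nat -> R) :
  generic_heights n x h ->
  lebesgue_vec R d (convex_hull [set psum x k | k in [set k | (k <= n)%N]]) =
  ((d`!%:R)^-1 * \sum_(j : {ffun 'I_d -> 'I_n.+1} | composition n (fun k => j k))
     \sum_(a < (n - \sum_k j k).+1) facet_weight n x h a (fun k => j k))%:E.
Proof.
move=> gen; set p := fun q : 'I_n.+1 => psum x q.
have -> : [set psum x k | k in [set k | (k <= n)%N]] = range p.
  apply/seteqP; split => [_ /= [k kn <-]|_ [q _ <-]].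
    by exists (Ordinal (kn : (k < n.+1)%N)).
  by exists (val q) => //=; rewrite leq_ord.
pose K : finType := ('I_n.+1 * {ffun 'I_d -> 'I_n.+1})%type.
pose adm (k : K) := composition n (fun i => k.2 i) && (k.1 + \sum_i k.2 i <= n)%N.
pose good (k : K) := [&& adm k, step_matrix x k.1 (fun i => k.2 i) \in unitmx &
  lower_facet x h n k.1 (fun i => k.2 i)].
pose F (k : K) := facet_simplex x k.1 (fun i => k.2 i).
have adm0 k : adm k -> forall l, (0 < k.2 l)%N.
  by move=> /andP[/andP[/forallP]].
have mF k : measurable (F k) by exact: measurable_facet_simplex.
pose U := \big[setU/set0]_(k <- enum good) F k.
have mU : measurable U by exact: bigsetU_measurable.
have UP y : U y <-> exists2 k, good k & F k y.
  rewrite /U -bigcup_seq; split => [[k /=]|[k gk Fk]].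
    by rewrite mem_enum => gk Fk; exists k.
  by exists k => //=; rewrite mem_enum.
have mC := @measurable_convex_hull _ _ _ p.
have UC : U `<=` convex_hull (range p).
  move=> y /UP[k /and3P[adk u _] Fk]; rewrite convex_hullE /=.
  have /andP[_ an] := adk.
  by have [l lw _] := facet_simplex_weights (adm0 _ adk) an u Fk; exists l.
have CU : lebesgue_vec R d (convex_hull (range p) `\` U) = 0%E.
  apply/negligibleP; first exact: measurableD.
  apply: negligibleS (negligible_deficient p) => y [].
  rewrite convex_hullE => -[l lw] yU; apply: contrapT => ynd; apply: yU.
  have ygen m : convex_weights p y m -> (d < #|weight_supp m|)%N.
    by move=> mw; rewrite ltnNge; apply/negP => md; apply: ynd; exists m.
  have [a [j [j0 ajn u low ys]]] := facet_exists gen lw ygen.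
  have an : (a < n.+1)%N by rewrite ltnS (leq_trans _ ajn)// leq_addr.
  have jn k : (j k < n.+1)%N.
    rewrite ltnS (leq_trans _ ajn)//.
    by rewrite (bigD1 k)//= addnCA leq_addr.
  pose j' : {ffun 'I_d -> 'I_n.+1} := [ffun k => Ordinal (jn k)].
  have jE : (fun k => nat_of_ord (j' k)) = j by apply/funext => k; rewrite ffunE.
  have sE : (\sum_k j' k = \sum_k j k)%N by apply: eq_bigr => k _; rewrite ffunE.
  apply/UP; exists (Ordinal an, j'); last by rewrite /F /= jE.
  rewrite /good /adm /= jE u low andbT andbT sE ajn andbT /composition.
  rewrite (leq_trans _ ajn) ?leq_addl// andbT.
  exact/forallP.
have UE : lebesgue_vec R d U = (\sum_(k <- enum good) lebesgue_vec R d (F k))%E.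
  apply: measure_big_setU => //; first exact: enum_uniq.
  move=> [a j] [a' j']; rewrite !mem_enum => /and3P[adk u low] /and3P[adk' u' low'].
  move=> ne; apply/seteqP; split => // y [ya ya'].
  have /andP[_ an] := adk; have /andP[_ an'] := adk'.
  have [e1 e2] := facet_unique (adm0 _ adk) an (adm0 _ adk') an' u u' low low' ya ya'.
  case/eqP: ne; congr pair; first exact: val_inj.
  by apply/ffunP => k; apply/val_inj/e2.
rewrite -(setDUK UC) measureU//; [|exact: measurableD|exact: setDIK].
rewrite [X in (_ + X)%E]CU adde0 [LHS]UE.
rewrite big_enum/= (eq_bigr (fun k : K =>
  ((d`!%:R)^-1 * facet_weight n x h k.1 (fun i => k.2 i))%:E)); last first.
  move=> k /and3P[_ u low]; rewrite lebesgue_facet_simplex// /facet_weight low.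
  by rewrite mul1r mulrC.
rewrite sumEFin -mulr_sumr; congr (_ * _)%:E.
transitivity (\sum_(k : K | adm k) facet_weight n x h k.1 (fun i => k.2 i)).
  rewrite big_mkcond [RHS]big_mkcond; apply: eq_bigr => k _.
  rewrite /good -[_ \in _]/(good k) /good; case: (adm k) => //=.
  case: (boolP (_ \in unitmx)) => [u|] /=; last first.
    by rewrite unitmxE unitfE negbK => /eqP e; rewrite /facet_weight e normr0 mulr0.
  by rewrite /facet_weight; case: (lower_facet _ _ _ _ _) => //; rewrite mul0r.
rewrite -(pair_big_dep (fun a : 'I_n.+1 => true) 
   (fun (a : 'I_n.+1) (j : {ffun 'I_d -> 'I_n.+1}) => adm (a, j))
   (fun (a : 'I_n.+1) (j : {ffun 'I_d -> 'I_n.+1}) => facet_weight n x h a (fun i => j i)))/=.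
rewrite (exchange_big_dep (fun j : {ffun 'I_d -> 'I_n.+1} => composition n (fun k => j k)))/=;
  last by move=> a j _ /andP[].
apply: eq_bigr => j jc; have /andP[_ jn] := jc.
rewrite (big_ord_widen_cond n.+1 predT (fun a : nat => facet_weight n x h a (fun i => j i))).
  apply: eq_bigl => a; rewrite /adm /= jc /= ltnS.
  by rewrite addnC -leq_subRL.
by rewrite ltnS leq_subr.
Qed.

End volume.

(** * Rotations of blocks of steps *)

Section rotation.
Implicit Types (b m t q i : nat).

Definition rotate b m t i : nat :=
  if (b <= i < b + m)%N then (b + (i - b + t) %% m)%N else i.

Lemma rotate_lt b m t i : (i < b)%N -> rotate b m t i = i.
Proof. by move=> ib; rewrite /rotate leqNgt ib. Qed.

Lemma rotate_ge b m t i : (b + m <= i)%N -> rotate b m t i = i.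
Proof. by move=> bi; rewrite /rotate [(i < _)%N]ltnNge bi andbF. Qed.

Lemma rotate_add b m t i : (i < m)%N -> rotate b m t (b + i) = (b + (i + t) %% m)%N.
Proof. by move=> im; rewrite /rotate leq_addr ltn_add2l im /= addKn. Qed.

Variables (V : zmodType) (f : nat -> V).

Lemma psumS q : psum f q.+1 = psum f q + f q.
Proof. by rewrite /psum big_ord_recr. Qed.

End rotation.

Section psum_rotate.
Variables (V : zmodType) (f : nat -> V) (b m t : nat).
Implicit Types (q p : nat).
Let g := f \o rotate b m t.

Lemma psum_rotate_le q : (q <= b)%N -> psum g q = psum f q.
Proof.
elim: q => [|q IH] qb; first by rewrite /psum !big_ord0.
by rewrite !psumS IH 1?ltnW// /g /= rotate_lt.
Qed.

(** Before the wrap-around the rotated block reads the original steps from [b + t] on;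
    [psum_rotate_hi] treats the times after it, and both apply at [p = m - t]. *)
Lemma psum_rotate_lo p : (p + t <= m)%N ->
  psum g (b + p) = psum f b + psum f (b + t + p) - psum f (b + t).
Proof.
elim: p => [|p IH] pm; first by rewrite !addn0 psum_rotate_le// addrK.
rewrite !addnS !psumS IH 1?ltnW//.
rewrite /g /= rotate_add; last by rewrite (leq_trans _ pm)// ltn_addr.
rewrite modn_small// [in RHS]addrA [RHS]addrAC; congr (_ + f _).
by rewrite addnA addnAC.
Qed.

Lemma psum_rotate_hi p : (t <= m)%N -> (p <= m)%N -> (m <= p + t)%N ->
  psum g (b + p) =
  psum f (b + m) - psum f (b + t) + psum f (b + (p + t - m)).
Proof.
move=> tm; elim: p => [|p IH] pm mpt.
  have <- : t = m by apply/eqP; rewrite eqn_leq tm.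
  by rewrite add0n subnn !addn0 subrr add0r psum_rotate_le.
have [mp|pt] := leqP m (p + t); last first.
  have e : (p.+1 + t)%N = m by apply/eqP; rewrite eqn_leq mpt addSn pt.
  rewrite psum_rotate_lo ?e// -addnA [(t + _)%N]addnC e subnn addn0.
  by rewrite addrAC [RHS]addrC addrA addrAC.
rewrite addnS psumS IH ?(ltnW pm)// /g /= rotate_add// addSn subSn// addnS psumS.
rewrite [in RHS]addrA; congr (_ + f _); congr (b + _)%N.
by rewrite -{1}(subnK mp) modnDr modn_small//; lia.
Qed.

Lemma psum_rotate_ge q : (t <= m)%N -> (b + m <= q)%N -> psum g q = psum f q.
Proof.
move=> tm; elim: q => [|q IH] bq.
  by rewrite /psum !big_ord0.
move: bq; rewrite leq_eqVlt => /predU1P[<-|bq].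
  by rewrite psum_rotate_hi ?leq_addr// addKn subrK.
by rewrite !psumS IH// /g /= rotate_ge.
Qed.

End psum_rotate.

Section perm_ext.
Variable n : nat.

Definition perm_ext (s : 'S_n) (i : nat) : nat :=
  if insub i is Some i' then val (s i') else i.

Lemma perm_ext_ord (s : 'S_n) (i : 'I_n) : perm_ext s i = s i.
Proof. by rewrite /perm_ext valK. Qed.

Lemma perm_ext_ge (s : 'S_n) i : (n <= i)%N -> perm_ext s i = i.
Proof. by move=> ni; rewrite /perm_ext insubF// ltnNge ni. Qed.

Lemma perm_ext_lt (s : 'S_n) i : (i < n)%N -> (perm_ext s i < n)%N.
Proof. by move=> ltin; rewrite (perm_ext_ord s (Ordinal ltin)). Qed.

Lemma perm_ext_inj (s : 'S_n) : injective (perm_ext s).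
Proof.
move=> i i'; have [ltin|ni] := ltnP i n; have [ltin'|ni'] := ltnP i' n.
- rewrite (perm_ext_ord s (Ordinal ltin)) (perm_ext_ord s (Ordinal ltin')).
  by move=> /val_inj/perm_inj/(congr1 val).
- by rewrite [X in _ = X]perm_ext_ge// => e; have := perm_ext_lt s ltin;
  rewrite e ltnNge ni'.
- by rewrite perm_ext_ge// => e; have := perm_ext_lt s ltin'; rewrite -e ltnNge ni.
- by rewrite !perm_ext_ge.
Qed.

(** A rotation inside the first [n] indices is itself a permutation of them, so the sum is reindexed
    by a translation of the group. *)
Lemma sum_perm_rotate (W : nmodType) (F : (nat -> nat) -> W) b m t :
  (b + m <= n)%N ->
  \sum_(s : 'S_n) F (perm_ext s \o rotate b m t) = \sum_(s : 'S_n) F (perm_ext s).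
Proof.
move=> bmn.
have rn i : (i < n)%N -> (rotate b m t i < n)%N.
  rewrite /rotate; case: ifPn => // /andP[bi im] _.
  rewrite (leq_trans _ bmn)// ltn_add2l ltn_mod.
  by case: m im {bmn} => //; rewrite addn0 ltnNge bi.
have rinj : injective (fun i : 'I_n => Ordinal (rn i (ltn_ord i))).
  move=> i i' /(congr1 val) /=; rewrite /rotate => e; apply: val_inj.
  move: e; case: ifPn => [/andP[bi im]|ni]; case: ifPn => [/andP[bi' im']|ni'].
  - move=> /addnI /eqP; rewrite eqn_modDr !modn_small ?ltn_subLR// => /eqP e.
    by rewrite /= -(subnK bi) e subnK.
  - move=> e; have m0 : (0 < m)%N by lia.
    by move: ni'; rewrite -e leq_addr ltn_add2l ltn_mod m0.
  - move=> e; have m0 : (0 < m)%N by lia.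
    by move: ni; rewrite e leq_addr ltn_add2l ltn_mod m0.
  - by [].
rewrite [RHS](reindex_inj (mulgI (perm rinj))); apply: eq_bigr => s _; congr F.
apply/funext => i /=; have [ltin|ni] := ltnP i n; last first.
  by rewrite rotate_ge ?perm_ext_ge// (leq_trans bmn).
rewrite (perm_ext_ord (perm rinj * s)%g (Ordinal ltin)) permM permE.
by rewrite -perm_ext_ord.
Qed.

End perm_ext.

(** Counts both the cyclic shifts that make a block positive and the starting times of a facet. *)
Lemma sum_unique_argmin (R : realDomainType) m (f : 'I_m -> R) : (0 < m)%N ->
  injective f -> \sum_a ([forall q, (q != a) ==> (f a < f q)]%:R : R) = 1.
Proof.
case: m f => // m f _ finj.
case: (@Order.TotalTheory.arg_minP _ _ _ ord0 predT f isT) => a _ amin.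
have aP : [forall q, (q != a) ==> (f a < f q)].
  apply/forallP => q; apply/implyP => qa.
  by rewrite lt_neqAle amin// andbT eq_sym (inj_eq finj).
rewrite (bigD1 a)//= aP big1 ?addr0// => b ba.
case: forallP => // /(_ a); rewrite eq_sym ba /= => ba_lt.
by have := amin b isT; rewrite leNgt ba_lt.
Qed.

(** * The facet condition under rotations, and its average over permutations *)

Section block_rotation.
Context {R : realType} {d : nat}.
Implicit Types (j : 'I_d -> nat) (a : nat) (x : nat -> 'cV[R]_d) (h : nat -> R).

(** The gap is again a walk, so the formulas for rotated partial sums apply to it. *)
Lemma gap_psum x h a j q :
  gap x h a j q = psum (fun i => h i - (slope x h a j *m x i) 0 0) q.
Proof.
rewrite /gap /psum sumrB; congr (_ - _).
by rewrite mulmx_sumr summxE.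
Qed.

Lemma eq_slope x h x' h' a a' j :
  (forall k, (k <= d)%N -> psum x' (vertex a' j k) - psum x' (vertex a' j 0) =
     psum x (vertex a j k) - psum x (vertex a j 0)) ->
  (forall k, (k <= d)%N -> psum h' (vertex a' j k) - psum h' (vertex a' j 0) =
     psum h (vertex a j k) - psum h (vertex a j 0)) ->
  step_matrix x' a' j = step_matrix x a j /\ slope x' h' a' j = slope x h a j.
Proof.
move=> ex eh.
have ed (V : zmodType) (f f' : nat -> V) :
    (forall k, (k <= d)%N -> f' k - f' 0%N = f k - f 0%N) ->
    forall k, (k < d)%N -> f' k.+1 - f' k = f k.+1 - f k.
  move=> e k kd; have B (u v w : V) : u - v = (u - w) - (v - w).
    by rewrite opprB addrA subrK.
  by rewrite (B _ _ (f' 0%N)) [RHS](B _ _ (f 0%N)) !e// ltnW.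
have eM : step_matrix x' a' j = step_matrix x a j.
  apply/matrixP => i k; rewrite !mxE.
  have := ed _ _ _ ex k (ltn_ord k) => e.
  by move/colP/(_ i): e; rewrite !mxE.
split => //; rewrite /slope eM; congr (_ *: (_ *m _)).
apply/rowP => k; rewrite !mxE.
exact: (ed _ (fun k => psum h (vertex a j k)) (fun k => psum h' (vertex a' j k))).
Qed.

Variable j : 'I_d -> nat.
Hypothesis j0 : forall l, (0 < j l)%N.
Let N := (\sum_k j k)%N.

Let offsetN : offset j d = N. Proof. exact: offset_full. Qed.

(** For an invertible step matrix the gap is 0 at both ends of the block, by [gap_offset]; the block
    is a bridge, and only its interior is constrained. *)
Definition positive_block x h (k : 'I_d) :=
  [forall p : 'I_(j k), (0 < p)%N ==> (0 < gap x h 0 j (offset j k + p))].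

Definition positive_blocks x h := [forall k, positive_block x h k].

Lemma gap_offset x h k : step_matrix x 0 j \in unitmx -> (k <= d)%N ->
  gap x h 0 j (offset j k) = 0.
Proof.
move=> u kd; have := gap_vertex h u kd; rewrite /vertex add0n => ->.
by rewrite gap_psum /psum big_ord0.
Qed.

(** This rotation carries the blocks from the times 0 to [N] to the times [a] to [a + N], and puts
    the [a] steps that followed them in front. *)
Lemma psum_rotate_front (V : zmodType) (f : nat -> V) a q : (q <= N)%N ->
  psum (f \o rotate 0 (a + N) N) (a + q) =
  psum f (a + N) - psum f N + psum f q.
Proof.
move=> qN; have := @psum_rotate_hi V f 0 (a + N) N (a + q).
rewrite !add0n leq_addl leq_add2l qN => ->//; last by lia.
by congr (_ + psum _ _); lia.
Qed.

Lemma step_slope_rotate_front x h a :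
  let r := rotate 0 (a + N) N in
  step_matrix (x \o r) a j = step_matrix x 0 j /\
  slope (x \o r) (h \o r) a j = slope x h 0 j.
Proof.
move=> r; have diff (V : zmodType) (f : nat -> V) k : (k <= d)%N ->
    psum (f \o r) (vertex a j k) - psum (f \o r) (vertex a j 0) =
    psum f (vertex 0 j k) - psum f (vertex 0 j 0).
  move=> kd; rewrite /vertex !psum_rotate_front ?add0n -?offsetN ?leq_offset//.
  by rewrite opprD addrACA subrr add0r.
exact: eq_slope (diff _ x) (diff _ h).
Qed.

(** The blocks together add 0 to the gap, so outside them one sees the walk of the remaining steps
    alone. *)
Lemma gap_rotate_front x h a : step_matrix x 0 j \in unitmx ->
  let x' := x \o rotate 0 (a + N) N in let h' := h \o rotate 0 (a + N) N in
  [/\ forall q, (q <= a)%N -> gap x' h' a j q = gap x h 0 j (N + q),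
   forall q, (q <= N)%N ->
     gap x' h' a j (a + q) = gap x h 0 j (N + a) + gap x h 0 j q &
   forall q, (a + N <= q)%N -> gap x' h' a j q = gap x h 0 j q].
Proof.
move=> u x' h'; have [_ ec] := step_slope_rotate_front x h a.
have E q : gap x' h' a j q =
    psum ((fun i => h i - (slope x h 0 j *m x i) 0 0) \o rotate 0 (a + N) N) q.
  by rewrite gap_psum ec.
have gN : gap x h 0 j N = 0 by rewrite -offsetN gap_offset.
move: gN; rewrite gap_psum => gN.
split => // q qa; rewrite E gap_psum.
- have := @psum_rotate_lo _ (fun i => h i - (slope x h 0 j *m x i) 0 0) 0 (a + N) N q.
  rewrite !add0n leq_add2r => ->//.
  by rewrite gN subr0 [X in X + _]/psum big_ord0 add0r.
- rewrite psum_rotate_front// gN subr0 [gap _ _ _ _ q]gap_psum; congr (psum _ _ + _).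
  exact: addnC.
- by rewrite psum_rotate_ge// leq_addl.
Qed.

Lemma interior_not_vertex a (k : 'I_d) p : (0 < p < j k)%N ->
  ~~ is_vertex a j (a + (offset j k + p)).
Proof.
move=> /andP[p0 pj]; apply/negP => /existsP[l].
rewrite eqn_add2l => /eqP e.
have [lk|kl] := leqP l k; first by have := leq_offset j lk; lia.
by have := leq_offset j kl; rewrite offsetS; lia.
Qed.

Lemma vertex_or_interior q : (q <= N)%N -> is_vertex 0 j q \/
  exists (k : 'I_d) p, (0 < p < j k)%N /\ q = (offset j k + p)%N.
Proof.
rewrite -offsetN.
suff H m : (m <= d)%N -> (q <= offset j m)%N -> is_vertex 0 j q \/
  exists (k : 'I_d) p, (0 < p < j k)%N /\ q = (offset j k + p)%N by exact: H.
elim: m => [_|m IH md].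
  rewrite offset0 leqn0 => /eqP->; left.
  by have := vertex_is_vertex 0 j (leq0n d); rewrite vertex0.
rewrite (offsetS j (Ordinal md)) /= => qm.
have [|mq] := leqP q (offset j m); first by apply: IH; exact: ltnW.
move: qm; rewrite leq_eqVlt => /predU1P[->|qm].
  by left; have := vertex_is_vertex 0 j md; rewrite /vertex add0n (offsetS j (Ordinal md)).
right; exists (Ordinal md), (q - offset j m)%N; rewrite subnKC ?(ltnW mq)//.
by split => //=; lia.
Qed.

(** Times inside the blocks give the positive bridges. Times outside give the minimum of the
    remaining walk, a time [q] past the blocks being its time [q - N]. *)
Lemma lower_facet_rotate x h n (a : 'I_(n - N).+1) : (N <= n)%N ->
  step_matrix x 0 j \in unitmx ->
  lower_facet (x \o rotate 0 (a + N) N) (h \o rotate 0 (a + N) N) n a j =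
  positive_blocks x h && [forall q : 'I_(n - N).+1,
    (q != a) ==> (gap x h 0 j (N + a) < gap x h 0 j (N + q))].
Proof.
move=> Nn u; have [lo mid hi] := gap_rotate_front h a u.
have ga := lo a (leqnn _).
have an : (a + N <= n)%N by have := leq_ord a; lia.
apply/forallP/andP => [low|[/forallP pos /forallP rest] q].
  have {}low q : (q <= n)%N -> ~~ is_vertex a j q -> gap x h 0 j (N + a) <
      gap (x \o rotate 0 (a + N) N) (h \o rotate 0 (a + N) N) a j q.
    rewrite -ltnS => qn qv; have := low (Ordinal qn).
    by rewrite qv /= ga.
  split; apply/forallP.
    move=> k; apply/forallP => p; apply/implyP => p0.
    have kN : (offset j k + p <= N)%N.
      rewrite -offsetN (leq_trans _ (leq_offset j (ltn_ord k)))// offsetS.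
      by rewrite leq_add2l ltnW.
    have := low (a + (offset j k + p))%N; rewrite mid// ltrDl; apply.
      by rewrite (leq_trans _ an)// leq_add2l.
    by apply: interior_not_vertex; rewrite p0 /=.
  move=> q; apply/implyP => qa; have [qlt|qge] := ltnP q a.
    rewrite -(lo q (ltnW qlt)); apply: low; first by lia.
    by apply/negP => /is_vertex_leq/andP[aq _]; rewrite leqNgt qlt in aq.
  have {}qge : (a < q)%N by rewrite ltn_neqAle eq_sym qa.
  rewrite -(hi (N + q)%N); last by rewrite addnC leq_add2l ltnW.
  apply: low; first by have := leq_ord q; lia.
  apply/negP => /is_vertex_leq/andP[_]; rewrite -/N addnC leq_add2r.
  by rewrite leqNgt qge.
apply/implyP => qv; rewrite ga.
have [qa|aq] := ltnP q a.
  rewrite lo ?(ltnW qa)//.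
  have qn : (q < (n - N).+1)%N by rewrite (ltn_trans qa).
  have := rest (Ordinal qn); rewrite -val_eqE /= ltn_eqF//=.
have [qaN|qaN] := leqP q (a + N).
  have {aq}qE : val q = (a + (q - a))%N by rewrite subnKC.
  have qN : (q - a <= N)%N by lia.
  rewrite [nat_of_ord q]qE mid// ltrDl.
  have [qv'|[k [p [/andP[p0 pk] ->]]]] := vertex_or_interior qN.
    case/existsP: qv' => k; rewrite /vertex add0n => /eqP qk.
    by move: qv; rewrite [nat_of_ord q]qE qk vertex_is_vertex ?leq_ord.
  by have /forallP/(_ (Ordinal pk)) := pos k; rewrite p0.
rewrite hi ?(ltnW qaN)//.
have qn : (q - N < (n - N).+1)%N by have := leq_ord q; lia.
have := rest (Ordinal qn); rewrite -val_eqE /= subnKC; last by lia.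
by rewrite gtn_eqF//; lia.
Qed.

Lemma psum_rotate_block (V : zmodType) (f : nat -> V) (k : 'I_d) (t : 'I_(j k)) q :
  (q <= offset j k)%N \/ (offset j k + j k <= q)%N ->
  psum (f \o rotate (offset j k) (j k) t) q = psum f q.
Proof.
by move=> [qk|kq]; [rewrite psum_rotate_le|rewrite psum_rotate_ge// ltnW].
Qed.

Lemma step_slope_rotate x h (k : 'I_d) (t : 'I_(j k)) :
  let r := rotate (offset j k) (j k) t in
  step_matrix (x \o r) 0 j = step_matrix x 0 j /\
  slope (x \o r) (h \o r) 0 j = slope x h 0 j.
Proof.
move=> r; have outv (l : nat) :
    (offset j l <= offset j k)%N \/ (offset j k + j k <= offset j l)%N.
  by have [lk|kl] := leqP l k; [left|right; rewrite -offsetS]; exact: leq_offset.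
by apply: eq_slope => l ld; rewrite /vertex !add0n !psum_rotate_block//; exact: outv.
Qed.

Lemma gap_rotate_block x h (k : 'I_d) (t : 'I_(j k)) :
  step_matrix x 0 j \in unitmx ->
  let r := rotate (offset j k) (j k) t in
  [/\ forall l p, l != k -> (p <= j l)%N ->
     gap (x \o r) (h \o r) 0 j (offset j l + p) = gap x h 0 j (offset j l + p) &
   forall p, (p < j k)%N -> gap (x \o r) (h \o r) 0 j (offset j k + p) =
     gap x h 0 j (offset j k + (p + t) %% j k) - gap x h 0 j (offset j k + t)].
Proof.
move=> u r; have tk := ltn_ord t; have [_ ec] := step_slope_rotate x h t.
have E q : gap (x \o r) (h \o r) 0 j q =
    psum ((fun i => h i - (slope x h 0 j *m x i) 0 0) \o r) q.
  by rewrite gap_psum ec.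
split => // [l p lk pl|p pk]; rewrite E gap_psum.
  rewrite psum_rotate_block//; have [lt|gt|e] := ltngtP l k.
  - by left; have := leq_offset j lt; rewrite offsetS; lia.
  - by right; have := leq_offset j gt; rewrite offsetS; lia.
  - by rewrite (val_inj e) eqxx in lk.
rewrite gap_psum.
have := gap_offset h u (ltnW (ltn_ord k)); rewrite gap_psum => gk.
have := gap_offset h u (ltn_ord k); rewrite gap_psum offsetS => gk1.
have [pt|pt] := leqP (j k) (p + t).
  rewrite psum_rotate_hi ?(ltnW tk) ?(ltnW pk)// gk1 sub0r addrC.
  rewrite -{2}(subnK pt) modnDr modn_small//; lia.
rewrite psum_rotate_lo ?(ltnW pt)// gk add0r modn_small//.
by rewrite addnAC addnA.
Qed.

(** The rotated bridge starts at the old time [t] and measures heights from there, so it is positive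
    exactly when [t] is the strict minimum. *)
Lemma positive_block_rotate x h (k : 'I_d) (t : 'I_(j k)) :
  step_matrix x 0 j \in unitmx ->
  let r := rotate (offset j k) (j k) t in
  positive_block (x \o r) (h \o r) k = [forall p : 'I_(j k), (p != t) ==>
    (gap x h 0 j (offset j k + t) < gap x h 0 j (offset j k + p))].
Proof.
move=> u r; have [_ E] := gap_rotate_block h t u.
apply/forallP/forallP => H p; apply/implyP.
  (* [q] is the time at which the rotated block visits the old time [p]. *)
  move=> pt; pose q := ((p + (j k - t)) %% j k)%N.
  have qk : (q < j k)%N by rewrite ltn_mod.
  have := H (Ordinal qk); rewrite /= E// subr_gt0 modnDml -addnA subnK ?(ltnW (ltn_ord t))//.
  rewrite modnDr modn_small// => /implyP; apply; rewrite lt0n.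
  apply: contra pt => /eqP q0; apply/eqP/val_inj.
  have pk := ltn_ord p; have tk := ltn_ord t; move: q0; rewrite /q /=.
  have [lt|ge] := ltnP p t; first by rewrite modn_small; lia.
  rewrite (_ : (p + (j k - t) = (p - t) + j k)%N); last by lia.
  by rewrite modnDr modn_small; lia.
move=> p0; rewrite E// subr_gt0.
have qk : ((p + t) %% j k < j k)%N by rewrite ltn_mod.
have /implyP := H (Ordinal qk); apply; rewrite -val_eqE /=.
apply/eqP; have pk := ltn_ord p; have tk := ltn_ord t.
have [lt|ge] := ltnP (p + t) (j k); first by rewrite modn_small; lia.
by rewrite -(subnK ge) modnDr modn_small; lia.
Qed.

Lemma positive_block_rotate_neq x h (k l : 'I_d) (t : 'I_(j k)) :
  step_matrix x 0 j \in unitmx -> l != k ->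
  let r := rotate (offset j k) (j k) t in
  positive_block (x \o r) (h \o r) l = positive_block x h l.
Proof.
move=> u lk r; have [E _] := gap_rotate_block h t u.
by apply: eq_forallb => p; rewrite E// ltnW.
Qed.

Variable n : nat.
Hypothesis Nn : (N <= n)%N.

Lemma generic_gap x h (q q' : nat) : generic_heights n x h ->
  step_matrix x 0 j \in unitmx -> (q < q' <= n)%N -> ~~ is_vertex 0 j q' ->
  gap x h 0 j q != gap x h 0 j q'.
Proof.
move=> gen u qq' qv; apply: contraNneq qv => e.
by have [] := gen 0%N j j0 Nn u q q' qq' e.
Qed.

Lemma sum_positive_block x h (k : 'I_d) : generic_heights n x h ->
  step_matrix x 0 j \in unitmx ->
  \sum_(t < j k) (positive_block (x \o rotate (offset j k) (j k) t)
    (h \o rotate (offset j k) (j k) t) k)%:R = 1 :> R.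
Proof.
move=> gen u; under eq_bigr do rewrite positive_block_rotate//.
apply: (sum_unique_argmin (f := fun p : 'I_(j k) => gap x h 0 j (offset j k + p))) => //.
(* The larger time [p'] is interior to the block, hence no vertex, and genericity separates the two
   gaps. *)
have lt (p p' : 'I_(j k)) : (p < p')%N ->
    gap x h 0 j (offset j k + p) != gap x h 0 j (offset j k + p').
  move=> pp'; apply: generic_gap => //.
    rewrite ltn_add2l pp' (leq_trans _ Nn)// -offsetN.
    rewrite (leq_trans _ (leq_offset j (ltn_ord k)))// offsetS leq_add2l.
    exact: ltnW.
  apply: (@interior_not_vertex 0 k p').
  by rewrite ltn_ord (leq_ltn_trans _ pp').
move=> p p' e; apply: val_inj; case: (ltngtP p p') => // pp'.
  by have := lt _ _ pp'; rewrite e eqxx.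
by have := lt _ _ pp'; rewrite e eqxx.
Qed.

Lemma sum_facet_weight_rotate x h : generic_heights n x h ->
  \sum_(a < (n - N).+1) facet_weight n (x \o rotate 0 (a + N) N)
    (h \o rotate 0 (a + N) N) a j =
  `|\det (step_matrix x 0 j)| * (positive_blocks x h)%:R.
Proof.
move=> gen; have [u|] := boolP (step_matrix x 0 j \in unitmx); last first.
  rewrite unitmxE unitfE negbK => /eqP d0; rewrite d0 normr0 mul0r.
  rewrite big1// => a _; rewrite /facet_weight.
  by have [-> _] := step_slope_rotate_front x h a; rewrite d0 normr0 mulr0.
pose f (a : 'I_(n - N).+1) := gap x h 0 j (N + a).
have finj : injective f.
  have lt (a a' : 'I_(n - N).+1) : (a < a')%N -> f a != f a'.
    move=> aa'; apply: generic_gap => //.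
      by have := leq_ord a'; lia.
    by apply/negP => /is_vertex_leq/andP[_]; rewrite -/N; lia.
  move=> a a' e; apply: val_inj; case: (ltngtP a a') => // aa'.
    by have := lt _ _ aa'; rewrite e eqxx.
  by have := lt _ _ aa'; rewrite e eqxx.
rewrite -[RHS]mulr1 -[X in _ = _ * X](sum_unique_argmin _ finj)// mulr_sumr.
apply: eq_bigr => a _; rewrite /facet_weight lower_facet_rotate//.
have [-> _] := step_slope_rotate_front x h a.
by rewrite -mulnb natrM mulrAC [_ * `|_|]mulrC.
Qed.

Variables (x : nat -> 'cV[R]_d) (h : nat -> R).
Hypothesis gen : forall s : 'S_n,
  generic_heights n (x \o perm_ext s) (h \o perm_ext s).

Let D (g : nat -> nat) : R := `|\det (step_matrix (x \o g) 0 j)|.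

(** Induction on the number [K] of blocks required to be positive. Averaging over the rotations of
    one more block changes neither the determinant nor the other blocks, and exactly one rotation
    succeeds, which gives the factor 1 / j_k. *)
Lemma sum_perm_positive_blocks :
  \sum_(s : 'S_n) D (perm_ext s) *
    (positive_blocks (x \o perm_ext s) (h \o perm_ext s))%:R =
  (\prod_k (j k)%:R)^-1 * \sum_(s : 'S_n) D (perm_ext s).
Proof.
pose W K g : R := D g *
  [forall k : 'I_d, (k < K)%N ==> positive_block (x \o g) (h \o g) k]%:R.
suff H K : (K <= d)%N -> \sum_(s : 'S_n) W K (perm_ext s) =
    (\prod_(k < d | (k < K)%N) (j k)%:R)^-1 * \sum_(s : 'S_n) D (perm_ext s).
  have -> : \prod_k (j k)%:R = \prod_(k < d | (k < d)%N) (j k)%:R :> R.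
    by apply: eq_bigl => k; rewrite ltn_ord.
  rewrite -H//.
  apply: eq_bigr => s _; rewrite /W; congr (_ * _%:R).
  by congr nat_of_bool; apply: eq_forallb => k; rewrite ltn_ord.
elim: K => [_|K IH Kd].
  have -> : \prod_(k < d | (k < 0)%N) (j k)%:R = 1 :> R by apply: big_pred0.
  rewrite invr1 mul1r; apply: eq_bigr => s _.
  by rewrite /W (_ : [forall k, _] = true) ?mulr1//; apply/forallP.
pose k0 := Ordinal Kd; have jk0 : (j k0)%:R != 0 :> R by rewrite pnatr_eq0 -lt0n.
rewrite (bigD1 k0) ?ltnSn//= invfM -mulrA.
rewrite (eq_bigl (fun k : 'I_d => (k < K)%N)); last first.
  by move=> k; rewrite ltnS [RHS]ltn_neqAle andbC.
rewrite -IH ?(ltnW Kd)//; apply: (mulfI jk0); rewrite mulVKf//.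
(* The factor [j k0] is spent on its rotations, each of which leaves the sum over permutations
   unchanged. *)
transitivity (\sum_(t < j k0) \sum_(s : 'S_n)
    W K.+1 (perm_ext s \o rotate (offset j k0) (j k0) t)).
  rewrite [LHS]mulr_natl -[j k0 in LHS]card_ord -sumr_const; apply: eq_bigr => t _.
  apply/esym/(sum_perm_rotate (W K.+1)).
  by rewrite -offsetS (leq_trans _ Nn)// -offsetN leq_offset.
rewrite exchange_big; apply: eq_bigr => s _ /=.
have Dt (t : 'I_(j k0)) : D (perm_ext s \o rotate (offset j k0) (j k0) t) =
    D (perm_ext s).
  by rewrite /D; have [-> _] := step_slope_rotate (x \o perm_ext s) (h \o perm_ext s) t.
rewrite /W; under eq_bigr do rewrite Dt.
have [u|] := boolP (step_matrix (x \o perm_ext s) 0 j \in unitmx); last first.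
  rewrite unitmxE unitfE negbK => /eqP d0.
  by rewrite /D d0 normr0 mul0r big1// => t _; rewrite mul0r.
rewrite -mulr_sumr; congr (_ * _).
set B := [forall k, _]; rewrite -[RHS]mulr1.
rewrite -[X in _ = _ * X](sum_positive_block k0 (@gen s) u) mulr_sumr.
apply: eq_bigr => t _; rewrite -natrM mulnb; congr (_%:R); congr nat_of_bool.
rewrite /B; apply/forallP/andP => [H|[/forallP H1 H2] k].
  split; last by have := H k0; rewrite /= ltnSn.
  apply/forallP => k; apply/implyP => kK; have := H k; rewrite ltnW//= => Hk.
  have kk0 : k != k0 by rewrite -val_eqE /= ltn_eqF.
  by rewrite -(positive_block_rotate_neq (h \o perm_ext s) t u kk0).
apply/implyP; rewrite ltnS leq_eqVlt => /predU1P[kK|kK].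
  by rewrite (_ : k = k0)//; exact: val_inj.
have := H1 k; rewrite kK /=.
have kk0 : k != k0 by rewrite -val_eqE /= ltn_eqF.
by rewrite -(positive_block_rotate_neq (h \o perm_ext s) t u kk0).
Qed.

Lemma sum_perm_facet_weight :
  \sum_(s : 'S_n) \sum_(a < (n - N).+1)
    facet_weight n (x \o perm_ext s) (h \o perm_ext s) a j =
  (\prod_k (j k)%:R)^-1 * \sum_(s : 'S_n) D (perm_ext s).
Proof.
rewrite -sum_perm_positive_blocks exchange_big /=.
transitivity (\sum_(a < (n - N).+1) \sum_(s : 'S_n)
    facet_weight n (x \o (perm_ext s \o rotate 0 (a + N) N))
      (h \o (perm_ext s \o rotate 0 (a + N) N)) a j).
  apply: eq_bigr => a _; apply/esym.
  apply: (sum_perm_rotate (fun g => facet_weight n (x \o g) (h \o g) a j)).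
  by have := leq_ord a; lia.
rewrite exchange_big /=; apply: eq_bigr => s _.
exact: sum_facet_weight_rotate.
Qed.

End block_rotation.

(** * Generic heights *)

Section generic.
Context {R : realType} {d : nat}.
Implicit Types (j : 'I_d -> nat) (x : nat -> 'cV[R]_d) (h : nat -> R).

Lemma poly_eventually_neq0 (P : {poly R}) : P != 0 ->
  exists T, forall t, (T <= t)%N -> P.[t%:R] != 0.
Proof.
move=> P0; exists (Num.bound (polyrcf.cauchy_bound P)) => t Tt.
apply/eqP => /(polyrcf.cauchy_boundP P0); rewrite normr_nat; apply/negP.
rewrite -leNgt (le_trans (ltW (archi_boundP _)))// ?ler_nat//.
by rewrite /polyrcf.cauchy_bound addr_ge0// mulr_ge0 ?invr_ge0// sumr_ge0.
Qed.

Lemma fin_eventually (K : finType) (P : K -> nat -> Prop) :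
  (forall k, exists T, forall t, (T <= t)%N -> P k t) ->
  exists T, forall k t, (T <= t)%N -> P k t.
Proof.
move=> /choice[T PT]; exists (\max_k T k)%N => k t Tt; apply: PT.
exact: leq_trans (leq_bigmax k) Tt.
Qed.

Lemma psum_diff (V : lmodType R) (f : nat -> V) n q q' : (q <= q' <= n)%N ->
  psum f q' - psum f q = \sum_(i < n) (q <= i < q')%N%:R *: f i.
Proof.
move=> /andP[qq' q'n].
have E p : (p <= n)%N -> psum f p = \sum_(i < n) (i < p)%N%:R *: f i.
  move=> pn; rewrite /psum (big_ord_widen _ f pn) big_mkcond/=.
  by apply: eq_bigr => i _; case: ifPn; rewrite ?scale1r ?scale0r.
rewrite !E ?(leq_trans qq')// -sumrB; apply: eq_bigr => i _.
rewrite -scalerBl; congr (_ *: _); case: (leqP q i) => qi /=.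
  by rewrite subr0.
by rewrite (leq_trans qi qq') subrr.
Qed.

(** The slope is linear in the heights; this is the coefficient of [h i] in the increment of the gap
    from [q] to [q']. *)
Definition gap_coef x a j (q q' i : nat) : R := (q <= i < q')%N%:R -
  \sum_k (invmx (step_matrix x a j) *m (psum x q' - psum x q)) k 0 *
    (vertex a j k <= i < vertex a j k.+1)%N%:R.

Lemma gap_coefE x h a j n (q q' : nat) : step_matrix x a j \in unitmx ->
  (a + \sum_k j k <= n)%N -> (q <= q' <= n)%N ->
  gap x h a j q' - gap x h a j q = \sum_(i < n) gap_coef x a j q q' i * h i.
Proof.
move=> u ajn qq'; rewrite /gap_coef.
under eq_bigr do rewrite mulrBl.
rewrite sumrB; have := psum_diff (h : nat -> R^o) qq'.
rewrite /GRing.scale/= => <-.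
set m := invmx _ *m _.
have -> : \sum_(i < n) (\sum_k m k 0 *
     (vertex a j k <= i < vertex a j k.+1)%N%:R) * h i =
    (slope x h a j *m (psum x q' - psum x q)) 0 0.
  under eq_bigr do rewrite mulr_suml.
  rewrite exchange_big /= slopeE// -mulmxA -/m mul_step_heights.
  apply: eq_bigr => k _; rewrite (psum_diff (h : nat -> R^o) (n := n)).
    by rewrite mulr_sumr; apply: eq_bigr => i _; rewrite mulrA.
  rewrite leq_vertex//= (leq_trans _ ajn)// leq_add2l -offset_full leq_offset//.
rewrite mulmxBr mxE [X in _ = _ - (_ + X)]mxE /gap; lra.
Qed.

(** If all coefficients vanished, the indicator of [q, q') would be a combination of block
    indicators, which jumps only at vertices; so [q] and [q'] would both be vertices. *)
Lemma gap_coef_neq0 x a j n (q q' : nat) : (a + \sum_k j k <= n)%N ->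
  (q < q' <= n)%N -> ~~ (is_vertex a j q && is_vertex a j q') ->
  exists2 i : nat, (i < n)%N & gap_coef x a j q q' i != 0.
Proof.
move=> ajn /andP[qq' q'n] qv; rewrite /gap_coef.
move: (invmx _ *m _) => m.
pose chi i : R := \sum_k m k 0 * (vertex a j k <= i < vertex a j k.+1)%N%:R.
have chiS i : ~~ is_vertex a j i.+1 -> chi i = chi i.+1.
  move=> iv; apply: eq_bigr => k _; congr (_ * _%:R); congr nat_of_bool.
  have vk l : (l <= d)%N -> vertex a j l != i.+1.
    by move=> ld; apply: contraNneq iv => <-; exact: vertex_is_vertex.
  have := vk k (ltnW (ltn_ord k)); have := vk k.+1 (ltn_ord k).
  by move: (vertex a j k) (vertex a j k.+1) => v w; lia.
have chi_out i : (i < a)%N \/ (a + \sum_k j k <= i)%N -> chi i = 0.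
  move=> ia; apply: big1 => k _; have av := leq_vertex a j (leq0n k).
  have va := leq_vertex a j (ltn_ord k); rewrite vertex0 in av.
  rewrite /vertex offset_full -/(vertex a j k.+1) in va.
  rewrite (_ : (_ <= _ < _)%N = false) ?mulr0//.
  by move: (vertex a j k) (vertex a j k.+1) av va => v w; lia.
apply: contrapT => H.
have {H} e0 i : (i < n)%N -> chi i = (q <= i < q')%N%:R.
  move=> ltin; apply/eqP; rewrite eq_sym -subr_eq0.
  by apply/negPn/negP => ne; apply: H; exists i.
have one_neq0 : (1 : R) != 0 by exact: oner_neq0.
move: qv; rewrite negb_and => /orP[qv|qv].
(* At [q = 0] there is no earlier index to compare with; instead index 0 precedes all blocks, where
   [chi] is 0. The end [q' = n] is treated symmetrically below. *)
- case: q qq' qv e0 => [|q] qq' qv e0.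
    have a0 : (0 < a)%N.
      rewrite lt0n; apply: contra qv => /eqP a0; rewrite a0.
      by have := vertex_is_vertex 0 j (leq0n d); rewrite vertex0.
    have := e0 0%N (leq_trans qq' q'n); rewrite qq' chi_out; last by left.
    by move/eqP; rewrite eq_sym (negPf one_neq0).
  have qn : (q.+1 < n)%N by exact: leq_trans q'n.
  have := chiS _ qv; rewrite (e0 q (ltnW qn)) (e0 q.+1 qn) ltnn leqnn qq' /=.
  by move/eqP; rewrite eq_sym (negPf one_neq0).
- have [p pE] : exists p, q' = p.+1 by case: (q') qq' => // p _; exists p.
  rewrite {}pE in qv qq' q'n e0; have qp : (q <= p)%N by rewrite -ltnS.
  have [q'lt|np] := ltnP p.+1 n.
    have := chiS p qv; rewrite (e0 p (ltnW q'lt)) (e0 p.+1 q'lt).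
    by rewrite qp ltnSn ltnn andbF => /eqP; rewrite (negPf one_neq0).
  have vp : (a + \sum_k j k)%N != p.+1.
    rewrite -offset_full; apply: contraNneq qv => <-.
    exact: (vertex_is_vertex a j (leqnn d)).
  have := e0 p q'n; rewrite ltnSn qp chi_out; last by right; lia.
  by move/eqP; rewrite eq_sym (negPf one_neq0).
Qed.

Lemma generic_powers n x : exists T, forall t (s : 'S_n), (T <= t)%N ->
  generic_heights n (x \o perm_ext s) ((fun i => t%:R ^+ i : R) \o perm_ext s).
Proof.
pose J := {ffun 'I_d -> 'I_n.+1}.
have [T HT] : exists T, forall (k : 'S_n * ('I_n.+1 * J) * ('I_n.+1 * 'I_n.+1)) t,
    (T <= t)%N -> let: (s, (a, j), (q, q')) := k in
    (a + \sum_l j l <= n)%N ->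
    step_matrix (x \o perm_ext s) a (fun l => j l) \in unitmx -> (q < q')%N ->
    gap (x \o perm_ext s) ((fun i => t%:R ^+ i) \o perm_ext s) a (fun l => j l) q =
    gap (x \o perm_ext s) ((fun i => t%:R ^+ i) \o perm_ext s) a (fun l => j l) q' ->
    is_vertex a (fun l => j l) q && is_vertex a (fun l => j l) q'.
  apply: fin_eventually => -[[s [a j]] [q q']].
  have [ajn|?] := boolP (a + \sum_l j l <= n)%N; last by exists 0%N.
  have [u|?] := boolP (step_matrix (x \o perm_ext s) a (fun l => j l) \in unitmx);
    last by exists 0%N.
  have [qq'|?] := boolP (q < q')%N; last by exists 0%N.
  have [v|v] := boolP (is_vertex a (fun l => j l) q && is_vertex a (fun l => j l) q').
    by exists 0%N.
  have q'n : (q < q' <= n)%N by rewrite qq' leq_ord.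
  pose c := gap_coef (x \o perm_ext s) a (fun l => j l) q q'.
  (* The exponents [s i] are distinct, so a nonzero [c i] survives as a coefficient of [P]. *)
  pose P : {poly R} := \sum_(i < n) c i *: 'X^(s i).
  have [i0 i0n ci0] := gap_coef_neq0 (x \o perm_ext s) ajn q'n v.
  have P0 : P != 0.
    apply: contra_neq ci0 => P0.
    have := congr1 (fun p : {poly R} => p`_(s (Ordinal i0n))) P0.
    rewrite coef0 coef_sum (bigD1 (Ordinal i0n))//= big1 => [|i ne].
      by rewrite coefZ coefXn eqxx mulr1 addr0.
    rewrite coefZ coefXn (inj_eq val_inj) (inj_eq perm_inj) eq_sym (negPf ne).
    by rewrite mulr0.
  have [T PT] := poly_eventually_neq0 P0.
  exists T => t /PT Pt _ _ _ e; exfalso; move/eqP: Pt; apply.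
  have qq'n : (q <= q' <= n)%N by rewrite ltnW// leq_ord.
  have := gap_coefE ((fun i => t%:R ^+ i) \o perm_ext s) u ajn qq'n.
  rewrite e subrr => ->; rewrite horner_sum; apply: eq_bigr => i _.
  by rewrite hornerZ hornerXn /= perm_ext_ord.
exists T => t s Tt a j j0 ajn u q q' /andP[qq' q'n] e.
have an : (a < n.+1)%N by rewrite ltnS (leq_trans _ ajn)// leq_addr.
have jn k : (j k < n.+1)%N.
  by rewrite ltnS (leq_trans _ ajn)// (bigD1 k)//= addnCA leq_addr.
pose j' : J := [ffun k => Ordinal (jn k)].
have jE : (fun k => nat_of_ord (j' k)) = j by apply/funext => k; rewrite ffunE.
have sE : (\sum_k j' k = \sum_k j k)%N by apply: eq_bigr => k _; rewrite ffunE.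
have qn : (q < n.+1)%N by lia.
have := HT (s, (Ordinal an, j'), (Ordinal qn, Ordinal (q'n : (q' < n.+1)%N))) t Tt.
rewrite /= sE jE => /(_ ajn u qq' e) /andP[? ?]; by split.
Qed.

End generic.

(** * Measurability on path space *)

Section path_space.
Context {dU} {U : measurableType dU}.

Lemma measurable_coordinate k :
  measurable_fun setT (fun x : path_space U => x k).
Proof.
move=> _ B mB; rewrite setTI; apply: sub_sigma_algebra.
by exists k => //; exists B => //; rewrite setTI.
Qed.

Lemma measurable_fun_path dT (T : measurableType dT) (f : T -> path_space U) :
  (forall k, measurable_fun setT (fun w => f w k)) -> measurable_fun setT f.
Proof.
move=> mf; pose G := [set A : set (path_space U) | measurable (f @^-1` A)].
suff sG : <<s @path_cylinders dU U >> `<=` G.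
  by move=> _ A mA; rewrite setTI; exact: sG.
apply: smallest_sub.
  split=> [|A|F]; rewrite /G /=.
  - by rewrite preimage_set0.
  - by rewrite setTD preimage_setC; exact: measurableC.
  - by move=> mF; rewrite preimage_bigcup; exact: bigcup_measurable.
move=> _ [k _ [B mB <-]]; rewrite setTI /G /=.
by have := mf k measurableT _ mB; rewrite setTI.
Qed.

End path_space.

Section measurable_volume.
Context {R : realType}.

Lemma measurable_fun_det dT (T : measurableType dT) m (f : T -> 'M[R]_m) :
  measurable_fun setT f -> measurable_fun setT (fun w => \det (f w)).
Proof.
move=> /measurable_fun_matrixP mf; apply: measurable_sum => s.
apply: measurable_funM => //; apply: measurable_prod => i _; exact: mf.
Qed.

Lemma measurable_fun_adj dT (T : measurableType dT) m (f : T -> 'M[R]_m) :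
  measurable_fun setT f -> measurable_fun setT (fun w => \adj (f w)).
Proof.
move=> /measurable_fun_matrixP mf; apply/measurable_fun_matrixP => i j.
under eq_fun do rewrite mxE; apply: measurable_funM => //.
apply: measurable_fun_det; apply/measurable_fun_matrixP => k l.
by under eq_fun do rewrite !mxE; exact: mf.
Qed.

Context {d : nat}.
Variable n : nat.
Implicit Types (j : 'I_d -> nat) (a : nat) (h : nat -> R).

(* Clearing the denominators of [gap] avoids the inverse of the determinant. *)
Lemma facet_weight_indic h a j (x : nat -> 'cV[R]_d) : facet_weight n x h a j =
  \1_(\bigcap_(q in [set q : 'I_n.+1 | ~~ is_vertex a j q])
    [set x : nat -> 'cV[R]_d |
      \det (step_matrix x a j) ^+ 2 * psum h a -
        \det (step_matrix x a j) *
        (step_heights h a j *m \adj (step_matrix x a j) *m psum x a) 0 0 <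
      \det (step_matrix x a j) ^+ 2 * psum h q -
        \det (step_matrix x a j) *
        (step_heights h a j *m \adj (step_matrix x a j) *m psum x q) 0 0]) x *
  `|\det (step_matrix x a j)|.
Proof.
rewrite /facet_weight; have [->|D0] := eqVneq (\det (step_matrix x a j)) 0.
  by rewrite normr0 !mulr0.
congr (_ * _); rewrite indicE; congr (_%:R); congr nat_of_bool.
have D2 : 0 < \det (step_matrix x a j) ^+ 2 by rewrite exprn_even_gt0//= orbF.
have E (q : nat) : \det (step_matrix x a j) ^+ 2 * psum h q -
    \det (step_matrix x a j) *
    (step_heights h a j *m \adj (step_matrix x a j) *m psum x q) 0 0 =
    \det (step_matrix x a j) ^+ 2 * gap x h a j q.
  rewrite /gap mulrBr /slope -[in RHS]scalemxAl [X in _ = _ - _ * X]mxE.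
  by rewrite mulrA expr2 -[_ * _ / _]mulrA divff// mulr1.
apply/forallP/idP => [low|].
  rewrite inE => q /= qv; rewrite !E ltr_pM2l//.
  by have := low q; rewrite qv.
rewrite inE => H q; apply/implyP => qv.
by have := H q qv; rewrite /= !E ltr_pM2l.
Qed.

Definition hull_volume (x : nat -> 'cV[R]_d) : \bar R :=
  lebesgue_vec R d (convex_hull [set psum x k | k in [set k | (k <= n)%N]]).

Lemma hull_volume_facets x h : generic_heights n x h -> hull_volume x =
  ((d`!%:R)^-1 * \sum_(j : {ffun 'I_d -> 'I_n.+1} | composition n (fun k => j k))
     \sum_(a < (n - \sum_k j k).+1) facet_weight n x h a (fun k => j k))%:E.
Proof. exact: lebesgue_convex_hull. Qed.

Lemma perm_ext1 : perm_ext (1 : 'S_n)%g =1 id.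
Proof.
move=> i; have [ltin|ni] := ltnP i n; last by rewrite perm_ext_ge.
by rewrite (perm_ext_ord _ (Ordinal ltin)) perm1.
Qed.

Section measurable_dependence.
Context {dT} {T : measurableType dT}.
Variable x : T -> nat -> 'cV[R]_d.
Hypothesis mx : forall k, measurable_fun setT (fun w => x w k).

Lemma measurable_psum q : measurable_fun setT (fun w => psum (x w) q).
Proof.
apply/measurable_fun_matrixP => i k; rewrite /psum.
under eq_fun do rewrite summxE.
apply: measurable_sum => m.
by move/measurable_fun_matrixP: (mx m); exact.
Qed.

Lemma measurable_step_matrix a j :
  measurable_fun setT (fun w => step_matrix (x w) a j).
Proof.
apply/measurable_fun_matrixP => i k; under eq_fun do rewrite mxE.
have : measurable_fun setT
    (fun w => psum (x w) (vertex a j k.+1) - psum (x w) (vertex a j k)).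
  by apply: measurable_fun_addmx; [|apply: measurable_fun_oppmx]; exact: measurable_psum.
by move/measurable_fun_matrixP; exact.
Qed.

Lemma measurable_facet_weight h a j :
  measurable_fun setT (fun w => facet_weight n (x w) h a j).
Proof.
under eq_fun do rewrite facet_weight_indic.
have mD : measurable_fun setT (fun w => \det (step_matrix (x w) a j)).
  exact/measurable_fun_det/measurable_step_matrix.
apply: measurable_funM; last exact: measurableT_comp.
set A := \bigcap_(q in _) _.
rewrite (_ : (fun w => _) = \1_(x @^-1` A)); last first.
  by apply/funext => w; rewrite !indicE; congr (_%:R); congr nat_of_bool;
    apply/idP/idP; rewrite !inE.
apply: measurable_indic; rewrite /A preimage_bigcap.
apply: fin_bigcap_measurable => // q _.
have mg p : measurable_fun setT (fun w =>
    \det (step_matrix (x w) a j) ^+ 2 * psum h p - \det (step_matrix (x w) a j) *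
    (step_heights h a j *m \adj (step_matrix (x w) a j) *m psum (x w) p) 0 0).
  apply: measurable_funB.
    by apply: measurable_funM => //; exact: measurable_funX.
  apply: measurable_funM => //.
  have : measurable_fun setT (fun w =>
      step_heights h a j *m \adj (step_matrix (x w) a j) *m psum (x w) p).
    apply: measurable_fun_mulmx; last exact: measurable_psum.
    apply: measurable_fun_mulmx; first exact: measurable_cst.
    exact/measurable_fun_adj/measurable_step_matrix.
  by move/measurable_fun_matrixP; exact.
exact: (measurable_lt_set (mg a) (mg q)).
Qed.

(** For each [w] the facet sum with heights t^i equals the volume once t is large, so the volume is
    a pointwise limit of measurable functions. *)
Lemma measurable_hull_volume : measurable_fun setT (fun w => hull_volume (x w)).
Proof.
pose F t w : \bar R :=
  ((d`!%:R)^-1 * \sum_(j : {ffun 'I_d -> 'I_n.+1} | composition n (fun k => j k))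
     \sum_(a < (n - \sum_k j k).+1)
       facet_weight n (x w) (fun i => t%:R ^+ i) a (fun k => j k))%:E.
apply: (emeasurable_fun_cvg F) => [t|w _].
  apply/measurable_EFinP; apply: measurable_funM => //.
  under eq_fun do rewrite -big_filter.
  apply: measurable_sum => j.
  by apply: measurable_sum => a; exact: measurable_facet_weight.
have [t0 HT] := generic_powers n (x w).
apply: cvg_near_cst; exists t0 => // t /= Tt; apply/esym/hull_volume_facets.
by have := HT t 1%g Tt; rewrite !(funext (perm_ext1)).
Qed.

End measurable_dependence.

(** Generic heights exist for every [x] and cancel from the result, so the identity holds without
    any assumption on [x]. *)
Lemma sum_perm_hull_volume x :
  (\sum_(s : 'S_n) hull_volume (x \o perm_ext s) =
  ((d`!%:R)^-1 * \sum_(j : {ffun 'I_d -> 'I_n.+1} | composition n (fun k => j k))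
    (\prod_k (j k)%:R)^-1 * \sum_(s : 'S_n)
      `|\det (step_matrix (x \o perm_ext s) 0 (fun k => j k))|)%:E)%E.
Proof.
have [T HT] := generic_powers n x.
have gen s := HT T s (leqnn T).
under eq_bigr => s _ do rewrite (hull_volume_facets (gen s)).
rewrite sumEFin -mulr_sumr; congr (_ * _)%:E.
rewrite exchange_big; apply: eq_bigr => j /andP[/forallP j0 jn] /=.
exact: (sum_perm_facet_weight j0 jn gen).
Qed.

End measurable_volume.

(** * Laws of independent sequences *)

Section law.
Context {R : realType} {dU} {U : measurableType dU}.

(** Prefixes suffice to determine a law: their cylinders are closed under intersection and generate
    the path space. *)
Definition prefix_independent dO (O : measurableType dO) (P : probability O R)
    (f : nat -> O -> U) :=
  forall N (B : nat -> set U), (forall i, measurable (B i)) ->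
  P (\bigcap_(i in `I_N) (f i @^-1` B i)) = (\prod_(i < N) P (f i @^-1` B i))%E.

Definition family_independent dO (O : measurableType dO) (P : probability O R)
    (I : choiceType) (f : I -> O -> U) :=
  forall (r : seq I) (B : I -> set U), uniq r -> (forall i, measurable (B i)) ->
  P (\bigcap_(i in [set` r]) (f i @^-1` B i)) = (\prod_(i <- r) P (f i @^-1` B i))%E.

Lemma mutually_independent_family dO (O : measurableType dO)
    (P : probability O R) (I : choiceType) (X : I -> {RV P >-> U}) :
  mutually_independent X -> family_independent P (fun i w => X i w).
Proof.
move=> iX r B ur mB; have := iX (seq_fset tt r) B mB.
have -> : [set` seq_fset tt r] = [set` r].
  by apply/seteqP; split => i; rewrite /mkset (seq_fsetE tt r i).
by move=> ->; apply: perm_big; rewrite -{2}(undup_id ur) seq_fset_perm.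
Qed.

Lemma independent_reindex dO (O : measurableType dO) (P : probability O R)
    (I : choiceType) (f : I -> O -> U) (c : nat -> I) :
  family_independent P f -> injective c ->
  prefix_independent P (fun i => f (c i)).
Proof.
move=> iX cinj N B mB; pose r := map c (iota 0 N).
have ur : uniq r by rewrite map_inj_uniq// iota_uniq.
(* The sets are carried along [c] by position in [r], without an inverse of [c]. *)
pose B' k := B (index k r).
have B'c i : (i < N)%N -> B' (c i) = B i.
  move=> iN; have e : nth 0%N (iota 0 N) i = i by rewrite nth_iota.
  by rewrite /B' index_map// -{1}e index_uniq ?size_iota ?iota_uniq.
transitivity (P (\bigcap_(k in [set` r]) (f k @^-1` B' k))).
  congr (P _); apply/seteqP; split => w /= H.
    move=> k /mapP[i]; rewrite mem_iota /= add0n => iN ->.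
    by rewrite /= B'c//; exact: H.
  move=> i /= iN; have := H (c i); rewrite /= B'c//; apply.
  by apply: map_f; rewrite mem_iota.
rewrite iX//; last by move=> k; exact: mB.
rewrite /r big_map -[N in iota 0 N]subn0 -/(index_iota 0 N) big_mkord.
by apply: eq_bigr => i _; rewrite B'c.
Qed.

(** Uniqueness of finite measures on the pi-system of prefix cylinders; a condition on one
    coordinate is such a cylinder with [setT] at the earlier ones. *)
Lemma law_unique dO (O : measurableType dO) (P : probability O R)
    dO' (O' : measurableType dO') (P' : probability O' R)
    (f : nat -> O -> U) (g : nat -> O' -> U) :
  (forall i, measurable_fun setT (f i)) -> (forall i, measurable_fun setT (g i)) ->
  prefix_independent P f -> prefix_independent P' g ->
  (forall i, same_distribution P P' (f i) (g i)) ->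
  same_distribution P P' (fun w => f ^~ w : path_space U) (fun w => g ^~ w).
Proof.
move=> mf mg indf indg fg A mA.
have mF : measurable_fun setT (fun w => f ^~ w : path_space U).
  exact: measurable_fun_path.
have mG : measurable_fun setT (fun w => g ^~ w : path_space U).
  exact: measurable_fun_path.
pose G := [set A : set (path_space U) | exists N (B : nat -> set U),
  (forall i, measurable (B i)) /\ A = [set x | forall i, (i < N)%N -> B i (x i)]].
have mcyl N (B : nat -> set U) : (forall i, measurable (B i)) ->
    measurable [set x : path_space U | forall i, (i < N)%N -> B i (x i)].
  move=> mB; rewrite (_ : [set _ | _] =
      \bigcap_(i in `I_N) ((fun x : path_space U => x i) @^-1` B i))//.
  apply: bigcap_measurableType => i _; rewrite -[X in measurable X]setTI.
  exact: measurable_coordinate.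
rewrite -[LHS]/(image_measure P mF A) -[RHS]/(image_measure P' mG A).
apply: (g_sigma_algebra_measure_unique G _ (fun=> setT)).
- by move=> _ [N [B [mB ->]]]; exact: mcyl.
- move=> _; exists 0%N, (fun=> setT); split => //.
  by apply/seteqP; split.
- by rewrite bigcup_const.
- move=> _ _ [N [B [mB ->]]] [N' [B' [mB' ->]]].
  exists (maxn N N'), (fun i => (if (i < N)%N then B i else setT) `&`
    (if (i < N')%N then B' i else setT)); split.
    by move=> i; apply: measurableI; case: ifP.
  apply/seteqP; split => x /=.
    by move=> [H H'] i _; split; case: ifP => // iN; [exact: H|exact: H'].
  move=> H; split => i iN; have [] := H i; rewrite ?leq_max ?iN ?orbT//.
- move=> _ [N [B [mB ->]]].
  have := indf N B mB; have := indg N B mB.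
  rewrite /image_measure /pushforward => e1 e2.
  transitivity (P (\bigcap_(i in `I_N) (f i @^-1` B i))); first by [].
  transitivity (P' (\bigcap_(i in `I_N) (g i @^-1` B i))); last by [].
  by rewrite e1 e2; apply: eq_bigr => i _; exact: fg.
- by move=> _; rewrite (le_lt_trans (@probability_le1 _ _ _ P setT measurableT))// ltry.
- move: A mA; apply: smallest_sub; first exact: smallest_sigma_algebra.
  move=> _ [k _ [B mB <-]]; apply: sub_sigma_algebra.
  exists k.+1, (fun i => if i == k then B else setT); split.
    by move=> i; case: ifP.
  apply/seteqP; split => x /=.
    by move=> [_ Bx] i _; case: eqP => [->|].
  by move=> H; split => //; have := H k (ltnSn k); rewrite eqxx.
Qed.

Lemma eq_integral_law dT (T : measurableType dT)
    dO (O : measurableType dO) (P : probability O R)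
    dO' (O' : measurableType dO') (P' : probability O' R)
    (f : O -> T) (g : O' -> T) (F : T -> \bar R) :
  measurable_fun setT f -> measurable_fun setT g ->
  same_distribution P P' f g -> measurable_fun setT F -> (forall x, 0 <= F x)%E ->
  (\int[P]_w F (f w) = \int[P']_w F (g w))%E.
Proof.
move=> mf mg fg mF F0.
have := ge0_integral_pushforward mf P measurableT mF (fun x _ => F0 x).
have := ge0_integral_pushforward mg P' measurableT mF (fun x _ => F0 x).
rewrite !preimage_setT => <- <-.
apply: (eq_measure_integral (image_measure P' mg) (m1 := image_measure P mf)).
by move=> A mA _; exact: fg.
Qed.

End law.

(** * The steps of the independent copies *)

Section increments.
Context {R : realType} {d : nat}.

(* The subtracted value is [0] rather than [s 0] at the first step, so that the
   steps sum to [s k] even when the path does not start at the origin. *)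
Definition path_step (s : nat -> 'cV[R]_d) (i : nat) : 'cV[R]_d :=
  s i.+1 - (if i == 0%N then 0 else s i).

Lemma sum_path_step s k : (0 < k)%N -> psum (path_step s) k = s k.
Proof.
case: k => // k _; elim: k => [|k IH].
  by rewrite psumS /psum big_ord0 add0r /path_step subr0.
by rewrite psumS IH /path_step /= addrC subrK.
Qed.

Lemma path_step_psum (f : nat -> 'cV[R]_d) i : path_step (psum f) i = f i.
Proof.
rewrite /path_step psumS; case: eqP => [->|_] /=; last by rewrite [LHS]addrC addKr.
by rewrite /psum big_ord0 add0r subr0.
Qed.

Lemma measurable_path_step i :
  measurable_fun setT (fun s : path_space 'cV[R]_d => path_step s i).
Proof.
apply: measurable_fun_addmx; first exact: measurable_coordinate.
apply: measurable_fun_oppmx; case: (i == 0%N); first exact: measurable_cst.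
exact: measurable_coordinate.
Qed.

Context {dO} {O : measurableType dO} {P : probability O R}.
Context {dO'} {O' : measurableType dO'} {P' : probability O' R}.
Variables (X : nat -> {RV P >-> 'cV[R]_d}) (I : finType).
Variable S : I -> {RV P' >-> path_space 'cV[R]_d}.
Hypothesis hX : mutually_independent X.
Hypothesis hSind : mutually_independent S.
Hypothesis hSlaw : forall k : I,
  same_distribution P P' (random_walk X : O -> path_space 'cV[R]_d) (S k).

Let walk_step w i : path_step (random_walk X w) i = X i w.
Proof. exact: (path_step_psum (fun i => X i w)). Qed.

Lemma step_distribution k i :
  same_distribution P P' (X i) (fun w => path_step (S k w) i).
Proof.
move=> B mB; pose A := [set s : path_space 'cV[R]_d | B (path_step s i)].
have mA : measurable A.
  by rewrite -[X in measurable X]setTI; exact: measurable_path_step.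
rewrite -[RHS](hSlaw k mA); congr (P _); apply/funext => w.
by rewrite /A /= walk_step.
Qed.

(** The finite family of steps is grouped by copy. Independence of the copies factors the groups;
    inside a group the law of the copy transfers the event to [X], whose steps are independent. *)
Lemma steps_independent :
  family_independent P' (fun (p : I * nat) w => path_step (S p.1 w) p.2).
Proof.
move=> r B ur mB.
pose A k := [set s : path_space 'cV[R]_d |
  forall i, (k, i) \in r -> B (k, i) (path_step s i)].
have mA k : measurable (A k).
  rewrite (_ : A k = \bigcap_(i in [set i | (k, i) \in r])
    [set s | B (k, i) (path_step s i)])//.
  apply: bigcap_measurableType => i _; rewrite -[X in measurable X]setTI.
  exact: measurable_path_step.
pose rk k := [seq p.2 | p <- r & p.1 == k].
have urk k : uniq (rk k).
  rewrite map_inj_in_uniq ?filter_uniq// => -[k1 i1] [k2 i2].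
  by rewrite !mem_filter /= => /andP[/eqP-> _] /andP[/eqP-> _] ->.
have rkE k i : (i \in rk k) = ((k, i) \in r).
  apply/mapP/idP => [[[k' i']]|kir].
    by rewrite mem_filter /= => /andP[/eqP-> ?] ->.
  by exists (k, i); rewrite // mem_filter /= eqxx.
transitivity (P' (\bigcap_(k in [set` enum I]) (S k @^-1` A k))).
  congr (P' _); apply/seteqP; split => w /= H.
    by move=> k _ i kir; exact: (H (k, i)).
  move=> [k i] kir /=; apply: (H k) => //=; exact: mem_enum.
have -> := mutually_independent_family hSind (enum_uniq I) mA.
rewrite [RHS](partition_big fst predT)//= big_enum/=; apply: eq_bigr => k _.
rewrite -[LHS](hSlaw k (mA k)).
transitivity (P (\bigcap_(i in [set` rk k]) (X i @^-1` B (k, i)))).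
  congr (P _); apply/seteqP; split => w /= H i.
    by rewrite /= rkE => kir; have := H i kir; rewrite walk_step.
  by rewrite -rkE => ir; rewrite walk_step; exact: (H i).
have -> := mutually_independent_family hX (urk k) (fun i => mB (k, i)).
rewrite big_map big_filter; apply: eq_bigr => -[k' i] /= /eqP ->.
exact: step_distribution.
Qed.

End increments.

Section block_index.
Context {R : realType} {d : nat}.
Variable j : 'I_d.+1 -> nat.

(* Times after the last block are sent to steps of the first walk beyond its
   block, which keeps the map injective on all of [nat]. *)
Definition block_index (p : nat) : 'I_d.+1 * nat :=
  if [pick k : 'I_d.+1 | (offset j k <= p < offset j k.+1)%N] is Some k
  then (k, (p - offset j k)%N) else (ord0, p).

Lemma block_index_inj : injective block_index.
Proof.
move=> p p'; rewrite /block_index.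
case: pickP => [k /andP[kp _]|_]; case: pickP => [k' /andP[kp' _]|_] [].
- by move=> e1 e; rewrite -e1 in kp' e; rewrite -(subnK kp) e subnK.
- by move=> ->; rewrite offset0 subn0.
- by move=> <-; rewrite offset0 subn0.
- by [].
Qed.

Lemma block_index_offset (k : 'I_d.+1) i : (i < j k)%N ->
  block_index (offset j k + i) = (k, i).
Proof.
move=> ik; rewrite /block_index; case: pickP => [k' /andP[lo hi]|/(_ k)]; last first.
  by rewrite leq_addr offsetS ltn_add2l ik.
have -> : k' = k.
  apply: val_inj; case: (ltngtP k' k) => // kk'.
    by have := leq_offset j kk'; lia.
  by have := leq_offset j kk'; rewrite offsetS; lia.
by rewrite addKn.
Qed.

(** During block [k] the glued sequence runs through the first [j k] steps of [Y k]. *)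
Lemma step_matrix_block_index (Y : 'I_d.+1 -> nat -> 'cV[R]_d.+1) :
  step_matrix (fun p => Y (block_index p).1 (block_index p).2) 0 j =
  \matrix_(i, k) psum (Y k) (j k) i 0.
Proof.
apply/matrixP => i k; rewrite [LHS]mxE [RHS]mxE.
congr (fun_of_matrix _ i 0); rewrite /vertex !add0n offsetS; set Z := fun p => Y _ _.
have H m : (m <= j k)%N -> psum Z (offset j k + m) = psum Z (offset j k) + psum (Y k) m.
  elim: m => [|m IH] mj; first by rewrite addn0 [psum (Y k) 0]/psum big_ord0 addr0.
  by rewrite addnS !psumS IH 1?ltnW// /Z block_index_offset//= addrA.
by rewrite H// addrC addKr.
Qed.

End block_index.

(** * Exchangeability, and blocks replaced by independent copies *)

Section iid_sequence.
Context {R : realType} {d : nat} {dO} {O : measurableType dO} {P : probability O R}.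
Variable X : nat -> {RV P >-> 'cV[R]_d}.
Hypothesis hX : iid X.

Lemma measurable_sequence (c : nat -> nat) :
  measurable_fun setT (fun w => (fun i => X (c i) w) : path_space 'cV[R]_d).
Proof. by apply: measurable_fun_path => k; exact: measurable_funP. Qed.

Lemma integral_iid_reindex (c : nat -> nat) (F : path_space 'cV[R]_d -> \bar R) :
  injective c -> measurable_fun setT F -> (forall x, 0 <= F x)%E ->
  (\int[P]_w F (fun i => X (c i) w) = \int[P]_w F (fun i => X i w))%E.
Proof.
move=> cinj mF F0.
apply: (@eq_integral_law _ _ (path_space 'cV[R]_d) _ _ P _ _ P
  (fun w i => X (c i) w) (fun w i => X i w) F _ _ _ mF F0).
- exact: measurable_sequence.
- exact: (measurable_sequence id).
- apply: (law_unique (f := fun i w => X (c i) w) (g := fun i w => X i w)).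
  + by move=> i; exact: measurable_funP.
  + by move=> i; exact: measurable_funP.
  + exact: (independent_reindex (mutually_independent_family hX.1) cinj).
  + exact: (independent_reindex (c := id) (mutually_independent_family hX.1)).
  + by move=> i A mA; rewrite (hX.2 (c i))// (hX.2 i).
Qed.

Context {dO'} {O' : measurableType dO'} {P' : probability O' R}.

(** The steps of the copies, glued by [block_index], form a sequence with the law of [X]; the blocks
    of one walk are thus distributed as the copies at the times [j k]. *)
Lemma integral_iid_steps (S : 'I_d -> {RV P' >-> path_space 'cV[R]_d})
    (j : 'I_d -> nat) (F : 'M[R]_d -> \bar R) :
  mutually_independent S ->
  (forall k : 'I_d, same_distribution P P'
    (random_walk X : O -> path_space 'cV[R]_d) (S k)) ->
  (forall l, 0 < j l)%N -> measurable_fun setT F -> (forall x, 0 <= F x)%E ->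
  (\int[P]_w F (step_matrix (fun i => X i w) 0 j) =
   \int[P']_w F (\matrix_(i, k) S k w (j k) i 0)%R)%E.
Proof.
(* In dimension 0 there is no walk to serve as the default of [block_index]; both integrands are
   constant there. *)
case: d X hX S j F => [|m] Y hY S j F hSind hSlaw j0 mF F0.
  have E (M : 'M[R]_0) : F M = F 0 by congr F; rewrite [M]flatmx0.
  under eq_integral do rewrite E; under [RHS]eq_integral do rewrite E.
  rewrite !integral_cst//=.
  by rewrite [P _]probability_setT [P' _]probability_setT.
pose f (p : 'I_m.+1 * nat) w := path_step (S p.1 w) p.2.
pose Z i w := f (block_index j i) w.
have mf p : measurable_fun setT (f p).
  apply: (measurableT_comp (measurable_path_step p.2)); exact: measurable_funP.
have E w : \matrix_(i, k) S k w (j k) i 0 = step_matrix (fun i => Z i w) 0 j.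
  rewrite (step_matrix_block_index j (fun k i => path_step (S k w) i)).
  by apply/matrixP => i k; rewrite !mxE sum_path_step.
under [RHS]eq_integral do rewrite E.
apply: (@eq_integral_law _ _ (path_space 'cV[R]_m.+1) _ _ _ _ _ _
  (fun w i => Y i w) (fun w i => Z i w) (fun x => F (step_matrix x 0 j))).
- by apply: measurable_fun_path => k; exact: measurable_funP.
- by apply: measurable_fun_path => k; exact: mf.
- apply: (law_unique (f := fun i w => Y i w) (g := Z)).
  + by move=> i; exact: measurable_funP.
  + by move=> i; exact: mf.
  + exact: (independent_reindex (c := id) (mutually_independent_family hY.1)).
  + exact: (independent_reindex (steps_independent hY.1 hSind hSlaw)
      (@block_index_inj m j)).
  + move=> i A mA; rewrite (hY.2 i)// -(hY.2 (block_index j i).2)//.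
    exact: step_distribution.
- apply: (measurableT_comp mF); apply: measurable_step_matrix.
  exact: measurable_coordinate.
- by [].
Qed.

End iid_sequence.

Theorem corollary2 (R : realType) (d n : nat) (hd : (1 <= d)%N) (hn : (d <= n)%N)
    (dO : measure_display) (O : measurableType dO) (P : probability O R)
    (X : nat -> {RV P >-> 'cV[R]_d}) (hX : iid X)
    (hgen : forall h : set 'cV[R]_d, affine_hyperplane h ->
      P (X 0%N @^-1` h) = 0%E)
    (dO' : measure_display) (O' : measurableType dO') (P' : probability O' R)
    (S : 'I_d -> {RV P' >-> path_space 'cV[R]_d})
    (hSind : mutually_independent S)
    (hSlaw : forall k : 'I_d,
      same_distribution P P' (random_walk X : O -> path_space 'cV[R]_d) (S k)) :
  (\int[P]_w lebesgue_vec R d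
      (convex_hull [set random_walk X w k | k in [set k | (k <= n)%N]]) =
   ((d`!%:R)^-1)%:E *
   \sum_(j : {ffun 'I_d -> 'I_n.+1}
         | [forall k, (1 <= j k)%N] && (\sum_k j k <= n)%N)
     'E_P'[fun w => `|\det (\matrix_(i, k) S k w (j k) i 0)|%R] *
     ((\prod_k (j k)%:R)^-1)%:E)%E.
Proof.
pose c : R := (d`!%:R)^-1; have c0 : 0 <= c by rewrite invr_ge0.
pose J := {ffun 'I_d -> 'I_n.+1}.
pose prd (j : J) : R := (\prod_k (j k)%:R)^-1.
have prd0 j : 0 <= prd j by rewrite invr_ge0 prodr_ge0.
pose E' (j : J) := ('E_P'[fun w => `|\det (\matrix_(i, k) S k w (j k) i 0)|%R])%E.
have E'0 j : (0 <= E' j)%E by exact: expectation_ge0.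
pose D (j : J) (x : path_space 'cV[R]_d) : \bar R :=
  `|\det (step_matrix x 0 (fun k => j k))|%:E.
have mabsdet : measurable_fun setT (fun M : 'M[R]_d => `|\det M|%:E).
  apply/measurable_EFinP; apply: measurableT_comp => //.
  by apply: measurable_fun_det; exact: measurable_id.
have mD j : measurable_fun setT (D j).
  apply: (measurableT_comp mabsdet); apply: measurable_step_matrix.
  exact: measurable_coordinate.
have mV : measurable_fun setT
    (fun x : path_space 'cV[R]_d => hull_volume n x).
  by apply: measurable_hull_volume; exact: measurable_coordinate.
have D0 j x : (0 <= D j x)%E by rewrite lee_fin.
have V0 (x : path_space 'cV[R]_d) : (0 <= hull_volume n x)%E by exact: measure_ge0.
have ED (s : 'S_n) (j : J) : composition n (fun k => j k) ->
    (\int[P]_w D j (fun i => X (perm_ext s i) w) = E' j)%E.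
  move=> /andP[/forallP j0 _].
  rewrite (integral_iid_reindex hX (@perm_ext_inj n s) (mD j) (D0 j)).
  rewrite /E' unlock.
  exact: (integral_iid_steps hX (F := fun M => `|\det M|%:E) hSind hSlaw j0 mabsdet).
have EV (s : 'S_n) : (\int[P]_w hull_volume n (fun i => X (perm_ext s i) w) =
    \int[P]_w hull_volume n (fun i => X i w))%E.
  by rewrite (integral_iid_reindex hX (@perm_ext_inj n s) mV V0).
pose js := [seq j : J <- index_enum J | composition n (fun k => j k)].
have nf0 : (n`!%:R : R) != 0 by rewrite pnatr_eq0 -lt0n fact_gt0.
(* Multiplied by [n!], the expected volume is a sum over permutations of equal terms; a nonzero
   finite factor cancels even when both sides are infinite. *)
suff H : ((n`!%:R)%:E * \int[P]_w hull_volume n (fun i => X i w) =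
    (n`!%:R)%:E * (c%:E * \sum_(j <- js) E' j * (prd j)%:E))%E.
  have /(congr1 (fun y => ((n`!%:R)^-1)%:E * y)%E) := H.
  rewrite !muleA -!EFinM mulVf// mul1e mul1r => e.
  by rewrite [LHS]e /js big_filter.
have sumS (y : \bar R) : (\sum_(s : 'S_n) y = (n`!%:R)%:E * y)%E.
  by rewrite mule_natl sumr_const card_Sn.
rewrite -[LHS]sumS (eq_bigr _ (fun s _ => esym (EV s))).
rewrite -ge0_integral_sum//; last first.
  by move=> s; apply: (measurableT_comp mV); exact: measurable_sequence.
(* The permutation identity is applied path by path, under the integral. *)
transitivity (\int[P]_w \sum_(j <- js) \sum_(s : 'S_n)
    ((c * prd j)%:E * D j (fun i => X (perm_ext s i) w)))%E.
  apply: eq_integral => w _.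
  have -> := sum_perm_hull_volume n (fun i => X i w).
  rewrite -big_filter -/js mulr_sumr -sumEFin; apply: eq_bigr => j _.
  rewrite mulrA mulr_sumr -sumEFin; apply: eq_bigr => s _.
  by rewrite EFinM.
have cp0 j : (0 <= (c * prd j)%:E)%E by rewrite lee_fin mulr_ge0.
have mDX s j : measurable_fun setT (fun w => D j (fun i => X (perm_ext s i) w)).
  by apply: (measurableT_comp (mD j)); exact: measurable_sequence.
rewrite ge0_integral_sum//; last 2 first.
- move=> j; apply: emeasurable_sum => s; exact: measurable_funeM.
- by move=> j w _; apply: sume_ge0 => s _; exact: mule_ge0.
(* The expectations may be infinite, so distributivity rests on nonnegativity of the terms. *)
rewrite ge0_sume_distrr; last by move=> j _; rewrite mule_ge0// lee_fin.
rewrite ge0_sume_distrr; last by move=> j _; rewrite !mule_ge0// lee_fin.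
rewrite big_seq [RHS]big_seq; apply: eq_bigr => j; rewrite mem_filter => /andP[cj _].
rewrite ge0_integral_sum//; last 2 first.
- by move=> s; exact: measurable_funeM.
- by move=> s w _; exact: mule_ge0.
rewrite -sumS; apply: eq_bigr => s _.
by rewrite ge0_integralZl// ED// EFinM -muleA [((prd j)%:E * _)%E]muleC.
Qed.
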